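(* Let $d\ge 1$ and let $G_1=(V_1,E_1),\dots,G_d=(V_d,E_d)$ be finite simple connected graphs, each having at least one edge, with a total order $\leq_i$ on each vertex set $V_i$. Let $\mathscr G=G_1\times\dots\times G_d$ with its induced simplicial structure, and let $\mathscr E=E_1\times\dots\times E_d$. Then the map of graded rings $$\prod_{\mathbf e\in\mathscr E}\iota_{\mathbf e}^*:\ \mathrm{Chow}_{\mathrm{GS}}(\mathscr G)\longrightarrow\prod_{\mathbf e\in\mathscr E}\mathrm{Chow}_{\mathrm{GS}}(\square_{\mathbf e})$$ is injective, and it identifies $\mathrm{Chow}_{\mathrm{GS}}(\mathscr G)$ with the kernel of the map $$j:\ \prod_{\mathbf e\in\mathscr E}\mathrm{Chow}_{\mathrm{GS}}(\square_{\mathbf e})\longrightarrow\prod_{i=1}^d\ \prod_{\mathbf x\in\mathscr E_i}\mathrm{Chow}_{\mathrm{GS}}(\square_{\mathbf x}).$$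
   Context: **Simplicial structure.** For finite simple connected graphs $G_i=(V_i,E_i)$, $1\le i\le d$ (a one-vertex graph is allowed in this definition), with total orders $\leq_i$ on $V_i$, the product $\mathscr G=G_1\times\dots\times G_d$ is the following simplicial set. Its vertex set is $\mathscr G_0=V_1\times\dots\times V_d$, with partial order $\mathbf u\le\mathbf v$ iff $u_i\leq_i v_i$ for all $i$. A 1-simplex is a pair $\mathbf u\le\mathbf v$ such that for each $i$ either $u_i=v_i$ or $\{u_i,v_i\}\in E_i$; put $I(\mathbf u,\mathbf v)=\{i: u_i<_i v_i\}$. A $k$-simplex is a sequence $\mathbf v_0\le\dots\le\mathbf v_k$ of vertices such that each consecutive pair is a 1-simplex and the sets $I(\mathbf v_j,\mathbf v_{j+1})$, $0\le j\le k-1$, are pairwise disjoint. Vertices (possibly repeated) ''form a simplex'' if they can be ordered into such a sequence. **Chow ring.** $Z(\mathscr G)=\mathbb Z[C_{\mathbf v}\mid\mathbf v\in\mathscr G_0]$, graded with each $C_{\mathbf v}$ of degree 1. The ideal $\mathscr I_{\mathrm{rat}}(\mathscr G)$ is generated by: - (R1) $C_{\mathbf v_1}\cdots C_{\mathbf v_k}$ whenever $\mathbf v_1,\dots,\mathbf v_k\in\mathscr G_0$ do not form a simplex; - (R2) $C_{\mathbf u}\sum_{\mathbf v\in\mathscr G_0}C_{\mathbf v}$ for $\mathbf u\in\mathscr G_0$; - (R3) $C_{\mathbf u}C_{\mathbf w}\sum_{\mathbf v\in\mathscr G_0:\,v_i=u_i}C_{\mathbf v}$ for $\mathbf u,\mathbf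 w\in\mathscr G_0$ and $1\le i\le d$ with $u_i\ne w_i$. $\mathrm{Chow}_{\mathrm{GS}}(\mathscr G)=Z(\mathscr G)/\mathscr I_{\mathrm{rat}}(\mathscr G)$. **Restriction maps.** If $H_i\subseteq G_i$ are subgraphs with induced orders and $\mathscr H=\prod_i H_i$, the inclusion $\mathscr H\hookrightarrow\mathscr G$ induces a well-defined homomorphism of graded rings $\mathrm{Chow}_{\mathrm{GS}}(\mathscr G)\to\mathrm{Chow}_{\mathrm{GS}}(\mathscr H)$ sending $C_{\mathbf v}$ to $C_{\mathbf v}$ if $\mathbf v\in\mathscr H_0$ and to $0$ otherwise. For $\mathbf e=(e_1,\dots,e_d)\in\mathscr E$, let $\square_{\mathbf e}=e_1\times\dots\times e_d$ (each edge $e_i$ seen as a subgraph of $G_i$ with two vertices), and let $\iota_{\mathbf e}^*:\mathrm{Chow}_{\mathrm{GS}}(\mathscr G)\to\mathrm{Chow}_{\mathrm{GS}}(\square_{\mathbf e})$ be the restriction map. **The map $j$.** The line graph $L(G)$ of a simple graph $G=(V,E)$ has vertex set $E$, and its edges are the pairs $\{e,e'\}$ of distinct edges of $G$ sharing a vertex. Put $\mathscr E_i=E_1\times\dots\times E_{i-1}\times E(L(G_i))\times E_{i+1}\times\dots\times E_d$. An element $\mathbf x\in\mathscr E_i$ consists of edges $e_j\in E_j$ for $j\ne i$ and a pair $\{e_{i,1},e_{i,2}\}$ of incident edges of $G_i$. It determines $\mathbf e_1,\mathbf e_2\in\mathscr E$, where $\mathbf e_k$ has $i$-th component $e_{i,k}$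 and $j$-th component $e_j$ for $j\neq i$, and the common facet $\square_{\mathbf x}=e_1\times\dots\times e_{i-1}\times(e_{i,1}\cap e_{i,2})\times e_{i+1}\times\dots\times e_d$, where $e_{i,1}\cap e_{i,2}$ is a one-vertex graph. Let $\iota_{\mathbf x,k}^*:\mathrm{Chow}_{\mathrm{GS}}(\square_{\mathbf e_k})\to\mathrm{Chow}_{\mathrm{GS}}(\square_{\mathbf x})$, $k=1,2$, be the restriction maps. The $\mathbf x$-component of $j$ sends $(\alpha_{\mathbf e})_{\mathbf e\in\mathscr E}$ to $\iota_{\mathbf x,1}^*(\alpha_{\mathbf e_1})-\iota_{\mathbf x,2}^*(\alpha_{\mathbf e_2})$ (the choice of which of the two edges is labelled first only affects the sign and is fixed arbitrarily). *)

(* Defs.v *)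
From HB Require Import structures.
From mathcomp Require Import mpoly boolp.
From mathcomp Require Import all_boot all_order all_algebra.

Set Implicit Arguments.
Unset Strict Implicit.
Unset Printing Implicit Defensive.

Import Order.TTheory GRing.Theory.
Local Open Scope ring_scope.
Local Open Scope quotient_scope.

(* Graphs on a subset of an ambient vertex type: the subgraphs of a graph live
   on the same ambient type, whose order they inherit. *)
Record graph (V : finType) := Graph {
  vset : {set V};
  adj : rel V;
  adj_sym : symmetric adj;
  adj_irr : irreflexive adj;
  adj_vset : forall x y, adj x y -> x \in vset
}.

Section Graph.
Variable V : finType.
Implicit Types (G H : graph V) (A : {set V}).

Definition edges G : {set {set V}} :=
  [set [set p.1; p.2] | p : V * V & adj G p.1 p.2].

Definition connected G : Prop :=
  {in vset G &, forall x y, connect (adj G) x y}.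

Definition subgraph H G : Prop :=
  (vset H \subset vset G) /\ subrel (adj H) (adj G).

Definition complete_adj A : rel V := fun x y => [&& x \in A, y \in A & x != y].

Fact complete_sym A : symmetric (complete_adj A).
Proof. by move=> x y; rewrite /complete_adj andbCA eq_sym. Qed.

Fact complete_irr A : irreflexive (complete_adj A).
Proof. by move=> x; rewrite /complete_adj eqxx !andbF. Qed.

Fact complete_vset A x y : complete_adj A x y -> x \in A.
Proof. by case/and3P. Qed.

(* For an edge e of G, this is e seen as a subgraph of G with two vertices. *)
Definition edge_graph A : graph V :=
  Graph (@complete_sym A) (@complete_irr A) (@complete_vset A).

Definition inter_adj G H : rel V := fun x y => adj G x y && adj H x y.

Fact inter_sym G H : symmetric (inter_adj G H).
Proof. by move=> x y; rewrite /inter_adj adj_sym [adj H _ _]adj_sym. Qed.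

Fact inter_irr G H : irreflexive (inter_adj G H).
Proof. by move=> x; rewrite /inter_adj adj_irr. Qed.

Fact inter_vset G H x y : inter_adj G H x y -> x \in vset G :&: vset H.
Proof. by rewrite inE => /andP[/adj_vset-> /adj_vset->]. Qed.

Definition inter_graph G H : graph V :=
  Graph (@inter_sym G H) (@inter_irr G H) (@inter_vset G H).

End Graph.

Notation edge G := {e | e \in edges G}.

Section LineGraph.
Variables (V : finType) (G : graph V).

Definition line_adj : rel (edge G) :=
  fun e e' => (e != e') && (val e :&: val e' != set0).

Fact line_sym : symmetric line_adj.
Proof. by move=> e e'; rewrite /line_adj eq_sym setIC. Qed.

Fact line_irr : irreflexive line_adj.
Proof. by move=> e; rewrite /line_adj eqxx. Qed.

Fact line_vset e e' : line_adj e e' -> e \in [set: edge G].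
Proof. by rewrite inE. Qed.

Definition line_graph : graph (edge G) := Graph line_sym line_irr line_vset.

End LineGraph.

Section Simplices.
Variables (disp : Order.disp_t) (d : nat) (V : 'I_d -> finOrderType disp).
Variable G : forall i, graph (V i).

Notation vertex := {v : {dffun forall i, V i} | [forall i, v i \in vset (G i)]}.
Implicit Types (u v : vertex) (s : seq vertex).

Definition one_simplex u v : bool :=
  [forall i, (val u i <= val v i)%O &&
             ((val u i == val v i) || adj (G i) (val u i) (val v i))].

(* The set I(u, v). *)
Definition moved u v : {set 'I_d} := [set i | (val u i < val v i)%O].

Definition simplex s : bool :=
  if s is v :: s' then
    path one_simplex v s' &&
    pairwise (fun A B : {set 'I_d} => [disjoint A & B]) (pairmap moved v s')
  else false.

(* The vertices of s, counted with multiplicity, can be ordered into a simplex. *)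
Definition form_simplex s : bool := has simplex (permutations s).

End Simplices.

Notation vertex G :=
  {v : {dffun forall i, _} | [forall i, v i \in vset (G i)]}.

Section Chow.
Variables (disp : Order.disp_t) (d : nat) (V : 'I_d -> finOrderType disp).
Variable G : forall i, graph (V i).

Definition Zpoly := {mpoly int[#|{: vertex G}|]}.
HB.instance Definition _ := GRing.ComNzRing.on Zpoly.

Definition C (v : vertex G) : Zpoly := 'X_(enum_rank v).

Inductive rat_gen : Zpoly -> Prop :=
| Rat1 (s : seq (vertex G)) of s != [::] & ~~ form_simplex s :
    rat_gen (\prod_(v <- s) C v)
| Rat2 (u : vertex G) :
    rat_gen (C u * \sum_v C v)
| Rat3 (u w : vertex G) (i : 'I_d) of val u i != val w i :
    rat_gen (C u * C w * \sum_(v : vertex G | val v i == val u i) C v).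

Definition Irat : {pred Zpoly} := fun p =>
  `[< exists2 s : seq (Zpoly * Zpoly),
        (forall x, x \in s -> rat_gen x.2) & p = \sum_(x <- s) x.1 * x.2 >].

Lemma IratP p :
  reflect (exists2 s : seq (Zpoly * Zpoly),
    (forall x, x \in s -> rat_gen x.2) & p = \sum_(x <- s) x.1 * x.2)
    (p \in Irat).
Proof. exact: asboolP. Qed.

Lemma rat_gen_Irat p : rat_gen p -> p \in Irat.
Proof.
move=> gp; apply/IratP; exists [:: (1, p)]; last by rewrite big_seq1 mul1r.
by move=> x; rewrite inE => /eqP->.
Qed.

Lemma rat_gen_eval0 p : rat_gen p -> p.@[fun=> 0] = 0.
Proof.
have ev0 v : (C v).@[fun=> 0] = 0 by rewrite mevalXU.
case=> [[//|v s] _ _|u|u w i _].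
- by rewrite big_cons mevalM ev0 mul0r.
- by rewrite mevalM ev0 mul0r.
- by rewrite !mevalM ev0 !mul0r.
Qed.

Fact Irat_idealr_closed : idealr_closed Irat.
Proof.
split=> [||a x y].
- by apply/IratP; exists [::]; rewrite ?big_nil.
- apply/IratP=> -[s gs /(congr1 (meval (fun=> 0)))].
  rewrite meval1 raddf_sum big_seq big1 => [/eqP|x xs]; first by rewrite oner_eq0.
  by rewrite /= mevalM (rat_gen_eval0 (gs _ xs)) mulr0.
- move=> /IratP[s gs ->] /IratP[t gt ->]; apply/IratP.
  exists ([seq (a * z.1, z.2) | z <- s] ++ t) => [z|].
    by rewrite mem_cat => /orP[/mapP[z' /gs g' ->]|/gt].
  rewrite big_cat big_map mulr_sumr; congr (_ + _).
  by apply: eq_bigr => z _; rewrite mulrA.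
Qed.

HB.instance Definition _ := isIdealr.Build Zpoly Irat Irat_idealr_closed.

Definition Chow := {ideal_quot Irat}.
HB.instance Definition _ := GRing.ComNzRing.on Chow.

Definition chow_class (p : Zpoly) : Chow := \pi_{ideal_quot Irat} p.

HB.instance Definition _ :=
  GRing.RMorphism.copy chow_class \pi_{ideal_quot Irat}.

Lemma chow_classP (x : Chow) : exists p, x = chow_class p.
Proof. by exists (repr x); rewrite /chow_class reprK. Qed.

(* The graded piece of degree n: the image of the polynomials of degree n. *)
Definition chow_homog (n : nat) (x : Chow) : Prop :=
  exists2 p : Zpoly, p \is n.-homog & x = chow_class p.

End Chow.

Arguments Irat {disp d V} G.
Arguments C {disp d V G}.
Arguments chow_class {disp d V G}.

Section Restriction.
Variables (disp : Order.disp_t) (d : nat) (V : 'I_d -> finOrderType disp).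
Variables G H : forall i, graph (V i).

Definition restr_var (v : vertex G) : Zpoly H :=
  if insub (val v) is Some w then C w else 0.

Definition restr_poly (p : Zpoly G) : Zpoly H :=
  mmap (@mpolyC #|{: vertex H}| int) (fun k => restr_var (enum_val k)) p.

HB.instance Definition _ := GRing.RMorphism.copy restr_poly
  (mmap (@mpolyC #|{: vertex H}| int) (fun k => restr_var (enum_val k))).

Lemma restr_polyC v : restr_poly (C v) = restr_var v.
Proof. by rewrite /restr_poly /C mmapX mmap1U enum_rankK. Qed.

Hypothesis sHG : forall i, subgraph (H i) (G i).

Fact incl_vertex_subproof (w : vertex H) : [forall i, val w i \in vset (G i)].
Proof.
apply/forallP=> i; have /forallP/(_ i) := valP w.
by apply: subsetP; case: (sHG i).
Qed.

Definition incl_vertex (w : vertex H) : vertex G :=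
  Sub (val w) (incl_vertex_subproof w).

Lemma restr_varE w : restr_var (incl_vertex w) = C w.
Proof. by rewrite /restr_var SubK valK. Qed.

Variant restr_var_spec (v : vertex G) : Zpoly H -> Type :=
| RestrIn w of v = incl_vertex w : restr_var_spec v (C w)
| RestrOut of ~~ [forall i, val v i \in vset (H i)] : restr_var_spec v 0.

Lemma restr_varP v : restr_var_spec v (restr_var v).
Proof.
rewrite /restr_var; case: insubP => [w _ wE|]; last exact: RestrOut.
by apply: RestrIn; apply: val_inj; rewrite SubK.
Qed.

Lemma restr_sum (P : pred {dffun forall i, V i}) :
  restr_poly (\sum_(v : vertex G | P (val v)) C v) =
  \sum_(w : vertex H | P (val w)) C w.
Proof.
rewrite raddf_sum /= (eq_bigr restr_var) => [|v _]; last exact: restr_polyC.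
rewrite (bigID (mem (codom incl_vertex))) /= [X in _ + X]big1 ?addr0; last first.
  move=> v /andP[_ vN]; case: restr_varP => // w vE.
  by rewrite vE codom_f in vN.
have injI : injective incl_vertex.
  by move=> w w' /(congr1 val); rewrite !SubK => /val_inj.
rewrite (eq_bigl (fun v => (v \in codom incl_vertex) && P (val v))) => [|v];
  last exact: andbC.
rewrite -big_filter_cond; set r := filter _ _.
have pr : perm_eq r (map incl_vertex (index_enum {: vertex H})).
  apply: uniq_perm.
  - by rewrite filter_uniq // index_enum_uniq.
  - by rewrite map_inj_uniq // index_enum_uniq.
  move=> v; rewrite mem_filter mem_index_enum andbT.
  apply/codomP/mapP=> [[w ->]|[w _ ->]]; exists w => //.
  by rewrite mem_index_enum.
rewrite (perm_big _ pr) big_map; apply: eq_big => [w|w _]; first by rewrite SubK.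
exact: restr_varE.
Qed.

Lemma simplex_incl (s : seq (vertex H)) :
  simplex s -> simplex (map incl_vertex s).
Proof.
case: s => //= v s /andP[ps ds]; apply/andP; split.
  elim: s v ps {ds} => //= w s IH v /andP[vw ps]; rewrite IH // andbT.
  apply/forallP=> i; have /forallP/(_ i) := vw; rewrite !SubK.
  case/andP=> -> /= /orP[->//|a]; apply/orP; right.
  by case: (sHG i) => _; apply.
suff -> : pairmap (@moved _ _ _ G) (incl_vertex v) (map incl_vertex s) =
          pairmap (@moved _ _ _ H) v s by [].
by elim: s v {ps ds} => //= w s IH v; rewrite IH.
Qed.

Lemma restr_rat_gen p : rat_gen p -> restr_poly p \in Irat H.
Proof.
case=> [s s0 nfs|u|u w i uw].
- rewrite rmorph_prod /=.
  rewrite (eq_bigr restr_var) => [|v _]; last exact: restr_polyC.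
  have [/allP sH|] := boolP (all (fun v : vertex G =>
      [forall i, val v i \in vset (H i)]) s); last first.
    case/allPn=> v vs vN; rewrite (big_rem v) //=.
    suff -> : restr_var v = 0 by rewrite mul0r rpred0.
    by case: restr_varP => // w vE; rewrite vE SubK (valP w) in vN.
  have [t st] : exists t, s = map incl_vertex t.
    elim: s {s0 nfs} sH => [|v s IH] sH; first by exists [::].
    have [|t ->] := IH; first by move=> x xs; apply: sH; rewrite inE xs orbT.
    have vH := sH v (mem_head _ _); exists (Sub (val v) vH :: t) => /=.
    by congr (_ :: _); apply: val_inj; rewrite !SubK.
  rewrite st big_map (eq_bigr C) => [|w _]; last exact: restr_varE.
  apply/rat_gen_Irat/Rat1; first by apply: contraNneq s0 => t0; rewrite st t0.
  apply: contra nfs => /hasP[t']; rewrite mem_permutations => pt st'.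
  apply/hasP; exists (map incl_vertex t'); last exact: simplex_incl.
  by rewrite mem_permutations st perm_map.
- rewrite rmorphM /= restr_polyC (restr_sum xpredT).
  case: restr_varP => [w _|_]; first exact/rat_gen_Irat/Rat2.
  by rewrite mul0r rpred0.
- rewrite !rmorphM /= !restr_polyC.
  rewrite (restr_sum (fun v : {dffun forall i, V i} => v i == val u i)).
  case: restr_varP => [u' uE|_]; last by rewrite !mul0r rpred0.
  case: restr_varP => [w' wE|_]; last by rewrite mulr0 mul0r rpred0.
  rewrite uE SubK; apply/rat_gen_Irat/Rat3.
  by move: uw; rewrite uE wE !SubK.
Qed.

Lemma restr_Irat p : p \in Irat G -> restr_poly p \in Irat H.
Proof.
case/IratP=> s gs ->; rewrite raddf_sum big_seq rpred_sum // => x xs /=.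
by rewrite rmorphM /= idealMr //; apply/restr_rat_gen/gs.
Qed.

(* The value does not depend on sHG, but the map is a ring morphism only in the
   presence of sHG, which is therefore kept as an argument. *)
Definition restr (x : Chow G) : Chow H := let _ := sHG in
  chow_class (restr_poly (repr x)).

Lemma restr_class p : restr (chow_class p) = chow_class (restr_poly p).
Proof.
apply/eqP; rewrite /restr /chow_class piE Quotient.equivE -rmorphB /=.
by rewrite restr_Irat // Quotient.idealrBE reprK.
Qed.

Fact restr_is_zmod_morphism : zmod_morphism restr.
Proof.
move=> x y; have [[p ->] [q ->]] := (chow_classP x, chow_classP y).
by rewrite -rmorphB !restr_class !rmorphB.
Qed.

Fact restr_is_monoid_morphism : monoid_morphism restr.
Proof.
split=> [|x y]; first by rewrite -(rmorph1 chow_class) restr_class !rmorph1.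
have [[p ->] [q ->]] := (chow_classP x, chow_classP y).
by rewrite -rmorphM !restr_class !rmorphM.
Qed.

HB.instance Definition _ :=
  GRing.isZmodMorphism.Build (Chow G) (Chow H) restr restr_is_zmod_morphism.
HB.instance Definition _ :=
  GRing.isMonoidMorphism.Build (Chow G) (Chow H) restr restr_is_monoid_morphism.

Lemma restr_C v : restr (chow_class (C v)) = chow_class (restr_var v).
Proof. by rewrite restr_class restr_polyC. Qed.

End Restriction.

Section ProductRing.
Variables (I : finType) (R : I -> comPzRingType).
Implicit Types x y z : {dffun forall i, R i}.

Definition prod_zero : {dffun forall i, R i} := finfun (fun i => 0).
Definition prod_one : {dffun forall i, R i} := finfun (fun i => 1).
Definition prod_opp x : {dffun forall i, R i} := finfun (fun i => - x i).
Definition prod_add x y : {dffun forall i, R i} := finfun (fun i => x i + y i).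
Definition prod_mul x y : {dffun forall i, R i} := finfun (fun i => x i * y i).

Fact prod_addA : associative prod_add.
Proof. by move=> x y z; apply/ffunP=> i; rewrite !ffunE addrA. Qed.
Fact prod_addC : commutative prod_add.
Proof. by move=> x y; apply/ffunP=> i; rewrite !ffunE addrC. Qed.
Fact prod_add0 : left_id prod_zero prod_add.
Proof. by move=> x; apply/ffunP=> i; rewrite !ffunE add0r. Qed.
Fact prod_addN : left_inverse prod_zero prod_opp prod_add.
Proof. by move=> x; apply/ffunP=> i; rewrite !ffunE addNr. Qed.
Fact prod_mulA : associative prod_mul.
Proof. by move=> x y z; apply/ffunP=> i; rewrite !ffunE mulrA. Qed.
Fact prod_mulC : commutative prod_mul.
Proof. by move=> x y; apply/ffunP=> i; rewrite !ffunE mulrC. Qed.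
Fact prod_mul1 : left_id prod_one prod_mul.
Proof. by move=> x; apply/ffunP=> i; rewrite !ffunE mul1r. Qed.
Fact prod_mulDl : left_distributive prod_mul prod_add.
Proof. by move=> x y z; apply/ffunP=> i; rewrite !ffunE mulrDl. Qed.

HB.instance Definition _ := GRing.isZmodule.Build {dffun forall i, R i}
  prod_addA prod_addC prod_add0 prod_addN.
HB.instance Definition _ := GRing.Zmodule_isComPzRing.Build
  {dffun forall i, R i} prod_mulA prod_mulC prod_mul1 prod_mulDl.

End ProductRing.

(* [glue f a] is the family with i-th component a and j-th component f j for
   j <> i. *)
Section Glue.
Variables (d : nat) (T : 'I_d -> Type) (i : 'I_d).
Variables (f : forall j : {j : 'I_d | j != i}, T (val j)) (a : T i).

Definition glue (j : 'I_d) : T j :=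
  match boolP (j != i) with
  | AltTrue ne => f (exist _ j ne)
  | AltFalse nne => eq_rect i T a j (esym (eqP (negbNE nne)))
  end.

Lemma glue_eq : glue i = a.
Proof.
rewrite /glue; case: {-}_ / boolP => [ne|nne]; first by case/eqP: (ne).
by rewrite (eq_irrelevance (esym _) (erefl i)).
Qed.

Lemma glue_neq j (ne : j != i) : glue j = f (exist _ j ne).
Proof.
rewrite /glue; case: {-}_ / boolP => [ne'|nne]; last by case/negP: nne.
by rewrite (bool_irrelevance ne' ne).
Qed.

End Glue.

Section Cubes.
Variables (disp : Order.disp_t) (d : nat) (V : 'I_d -> finOrderType disp).
Variable G : forall i, graph (V i).

Definition multiedge := {dffun forall i, edge (G i)}.

Definition cube (e : multiedge) : forall i, graph (V i) :=
  fun i => edge_graph (val (e i)).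

Lemma edge_subgraph i (e : edge (G i)) : subgraph (edge_graph (val e)) (G i).
Proof.
case: e => _ /= /imsetP[[x y] /= xy ->]; rewrite inE /= in xy.
have yx : adj (G i) y x by rewrite adj_sym.
split; first by rewrite subUset !sub1set (adj_vset xy) (adj_vset yx).
move=> u v /and3P[]; rewrite !inE => /orP[]/eqP-> /orP[]/eqP->.
all: by rewrite ?eqxx.
Qed.

Lemma cube_sub e : forall i, subgraph (cube e i) (G i).
Proof. by move=> i; apply: edge_subgraph. Qed.

Definition restr_cubes (x : Chow G) : {dffun forall e, Chow (cube e)} :=
  finfun (fun e => restr (cube_sub e) x).

Fact restr_cubes_is_zmod_morphism : zmod_morphism restr_cubes.
Proof. by move=> x y; apply/ffunP=> e; rewrite !ffunE rmorphB. Qed.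

Fact restr_cubes_is_monoid_morphism : monoid_morphism restr_cubes.
Proof.
by split=> [|x y]; apply/ffunP=> e; rewrite !ffunE (rmorph1, rmorphM).
Qed.

HB.instance Definition _ := GRing.isZmodMorphism.Build
  (Chow G) {dffun forall e, Chow (cube e)} restr_cubes
  restr_cubes_is_zmod_morphism.
HB.instance Definition _ := GRing.isMonoidMorphism.Build
  (Chow G) {dffun forall e, Chow (cube e)} restr_cubes
  restr_cubes_is_monoid_morphism.

(* Edges of G_j for j <> i, together with an edge of the line graph of G_i. *)
Definition multifacet (i : 'I_d) : Type :=
  {dffun forall j : {j | j != i}, edge (G (val j))} *
  edge (line_graph (G i)).

(* A choice, for each x in multifacet i, of which of its two incident edges
   comes first: the edges are [labels x true] and then [labels x false]. *)
Record labelling := Labelling {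
  labels :> forall i, multifacet i -> bool -> edge (G i);
  labelsP : forall i (x : multifacet i),
    val x.2 = [set labels x true; labels x false]
}.

Variable lab : labelling.

Definition facet_edge i (x : multifacet i) (b : bool) : multiedge :=
  finfun (glue (T := fun j => edge (G j)) (fun j => x.1 j) (lab i x b)).

Definition facet i (x : multifacet i) : forall j, graph (V j) :=
  glue (T := fun j => graph (V j))
    (fun j => edge_graph (val (x.1 j)))
    (inter_graph (edge_graph (val (lab i x true)))
                 (edge_graph (val (lab i x false)))).

Lemma facet_sub i (x : multifacet i) b :
  forall j, subgraph (facet x j) (cube (facet_edge x b) j).
Proof.
move=> j; rewrite /cube ffunE /facet.
have [ne|/negbNE/eqP->] := boolP (j != i).
  by rewrite !glue_neq; split.
rewrite !glue_eq; case: b; split.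
- exact: subsetIl.
- by move=> u v /andP[].
- exact: subsetIr.
- by move=> u v /andP[].
Qed.

Definition jmap (y : {dffun forall e, Chow (cube e)}) :
    {dffun forall i, {dffun forall x : multifacet i, Chow (facet x)}} :=
  finfun (fun i => finfun (fun x : multifacet i =>
    restr (facet_sub x true) (y (facet_edge x true)) -
    restr (facet_sub x false) (y (facet_edge x false)))).

Fact jmap_is_zmod_morphism : zmod_morphism jmap.
Proof.
move=> y z; apply/ffunP=> i; apply/ffunP=> x; rewrite !ffunE !rmorphB /=.
by rewrite !opprD !opprK addrACA.
Qed.

HB.instance Definition _ := GRing.isZmodMorphism.Build
  {dffun forall e, Chow (cube e)}
  {dffun forall i, {dffun forall x : multifacet i, Chow (facet x)}}
  jmap jmap_is_zmod_morphism.

End Cubes.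

Lemma labelling_exists (disp : Order.disp_t) (d : nat)
    (V : 'I_d -> finOrderType disp) (G : forall i, graph (V i)) :
  inhabited (labelling G).
Proof.
have ex i (x : multifacet G i) :
    exists e : edge (G i) * edge (G i), val x.2 == [set e.1; e.2].
  by case/imsetP: (valP x.2) => e _ ->; exists e.
split; exists (fun i x b =>
  let e := xchoose (ex i x) in if b then e.1 else e.2).
by move=> i x; apply/eqP/(xchooseP (ex i x)).
Qed.

(* Main.v *)
(* For every product G the group Chow G is free on explicit square-free
   monomials, and restriction sends such a monomial to itself or to 0.  Hence the
   theorem becomes a statement about families of integer coefficients: a monomial
   is seen by some cube, and two cubes which see it are joined by a chain of
   cubes with consecutive ones meeting in a facet which still sees it.

   The basis.  A simplex A with k moving coordinates orders these coordinates:
   first by the moment they rise along A, then increasingly.  This order spans a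
   maximal flag of the face of A, and A is called irredundant when it consists
   of the two ends of this flag and of its descents (this is the shelling basis of
   the triangulated cube).  Modulo the nonfaces, the polynomial ring is the direct
   sum over the irredundant simplices A of C_A Z[theta_A], where theta_A consists
   of t = sum_v C_v and of the y_i = sum_(v_i = upper value of A) C_v, for i
   moving in A.  Spanning is a straightening argument: on the flag of A each C_v
   is a difference of two elements of theta_A, so that replacing a redundant C_v
   by this difference lowers the degree, up to monomials whose support moves more
   coordinates or has more inversions.  Independence follows from the ring
   morphisms to Z[t, y_1, ..., y_d] given by restriction to a flag, on which
   theta_A is algebraically independent.  In this description the ideal of
   rational equivalence consists of the sums of C_A f with f in the ideal generated
   by theta_A, which leaves one copy of Z for each A. *)

From HB Require Import structures.
Require Import Defs.
From mathcomp Require Import mpoly boolp.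
From mathcomp Require Import all_boot all_order all_algebra.
From mathcomp Require Import zify.

Set Implicit Arguments.
Unset Strict Implicit.
Unset Printing Implicit Defensive.

Import Order.TTheory GRing.Theory.
Local Open Scope ring_scope.

(** * Chains with two values per coordinate *)

Section Level.
Variables (disp : Order.disp_t) (d : nat) (V : 'I_d -> finOrderType disp).
Local Notation P := {dffun forall i, V i}.
Implicit Types (u v w : P) (A B : {set P}) (i j : 'I_d).

Definition vle u v := forall i, (u i <= v i)%O.

Definition thin A : Prop :=
  {in A &, forall u v, vle u v \/ vle v u} /\
  {in A & &, forall u v w i, (u i < v i)%O -> (v i < w i)%O -> False}.

Definition moving A : {set 'I_d} :=
  [set i | [exists u in A, exists v in A, (u i < v i)%O]].

(* Some member of A has already risen in the coordinate j, but not yet in the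
   smaller coordinate i. *)
Definition inversions A : {set 'I_d * 'I_d} :=
  [set p : 'I_d * 'I_d | (p.1 < p.2)%N && [exists u in A, exists v in A, exists w in A,
     (u p.2 < v p.2)%O && (v p.1 < w p.1)%O]].

(** The invariant that decides redundancy. Its first component separates the empty set from a single
    point, neither of which has moving coordinates; a single point is thus irredundant. *)
Definition level A := (A != set0, moving A, inversions A).

Definition irredundant A := [forall v in A, level (A :\ v) != level A].

Definition weight A := ((A != set0) + #|moving A| + #|inversions A|)%N.

Lemma movingP A i :
  reflect (exists u v, [/\ u \in A, v \in A & (u i < v i)%O]) (i \in moving A).
Proof.
rewrite inE; apply: (iffP exists_inP) => [[u uA /exists_inP[v vA uv]]|[u[v[uA vA uv]]]].
  by exists u, v.
by exists u => //; apply/exists_inP; exists v.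
Qed.

Lemma inversionsP A i j :
  reflect ((i < j)%N /\ exists u v w,
      [/\ u \in A, v \in A, w \in A, (u j < v j)%O & (v i < w i)%O])
    ((i, j) \in inversions A).
Proof.
rewrite inE /=; apply: (iffP andP) => -[ij]; split=> //.
  move: b => /exists_inP[u uA /exists_inP[v vA /exists_inP[w wA /andP[]]]].
  by exists u, v, w.
case: b => u [v [w [uA vA wA uv vw]]].
apply/exists_inP; exists u => //; apply/exists_inP; exists v => //.
by apply/exists_inP; exists w => //; rewrite uv.
Qed.

Lemma moving_sub A B : A \subset B -> moving A \subset moving B.
Proof.
move=> /subsetP sAB; apply/subsetP=> i /movingP[u [v [/sAB uA /sAB vA uv]]].
by apply/movingP; exists u, v.
Qed.

Lemma inversions_sub A B : A \subset B -> inversions A \subset inversions B.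
Proof.
move=> /subsetP sAB; apply/subsetP=> -[i j] /inversionsP[ij].
case=> u [v [w [/sAB uA /sAB vA /sAB wA uv vw]]].
by apply/inversionsP; split=> //; exists u, v, w.
Qed.

Lemma thin_sub A B : A \subset B -> thin B -> thin A.
Proof.
move=> /subsetP sAB [cB tB]; split=> [u v /sAB uB /sAB|u v w /sAB uB /sAB vB /sAB].
  exact: cB.
exact: tB.
Qed.

Definition level_le A B := [/\ A != set0 -> B != set0,
  moving A \subset moving B & inversions A \subset inversions B].

Lemma level_le_sub A B : A \subset B -> level_le A B.
Proof.
move=> sAB; split; [|exact: moving_sub|exact: inversions_sub].
by apply: contra_neq => B0; apply/eqP; rewrite -subset0 -B0.
Qed.

(** Each summand of [weight] is monotone, so equal weights would force equality in all three
    components. *)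
Lemma level_le_weight A B : level_le A B ->
  level A <> level B -> (weight A < weight B)%N.
Proof.
case=> sn sm si nAB; rewrite /weight.
have l1 : ((A != set0) <= (B != set0))%N by case: (A != set0) sn => // ->.
have [l2 l3] := (subset_leq_card sm, subset_leq_card si).
case: (ltnP #|moving A| #|moving B|) => m2; first by lia.
case: (ltnP #|inversions A| #|inversions B|) => m3; first by lia.
case: (ltnP (A != set0) (B != set0)) => m1; first by lia.
case: nAB; rewrite /level; congr (_, _, _).
- by case: (A != set0) (B != set0) l1 m1 => -[].
- by apply/eqP; rewrite eqEcard sm.
- by apply/eqP; rewrite eqEcard si.
Qed.

Lemma weight_bound A : (weight A <= 1 + d + d * d)%N.
Proof.
rewrite /weight -!addnA; apply: leq_add; first by case: (_ != _).
apply: leq_add; first by rewrite -[X in (_ <= X)%N]card_ord max_card.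
by apply: leq_trans (max_card _) _; rewrite card_prod card_ord.
Qed.

Lemma vle_trans u v w : vle u v -> vle v w -> vle u w.
Proof. by move=> uv vw i; apply: le_trans (uv i) (vw i). Qed.

Lemma vle_refl u : vle u u.
Proof. by move=> i. Qed.

Lemma thin_min A : thin A -> A != set0 ->
  exists2 u, u \in A & {in A, forall v, vle u v}.
Proof.
case=> cA _ /set0Pn[u0 u0A].
(* A member with the most members above it is the least one: if [v] is below [u], all that lies
   above [u] lies above [v], and equal cardinalities then put [v] above [u]. *)
pose f u := #|[set v in A | `[< vle u v >]]|.
case: (arg_maxnP f u0A) => u uA umax; exists u => // v vA.
have [//|vu] := cA u v uA vA.
have sub : [set x in A | `[< vle u x >]] \subset [set x in A | `[< vle v x >]].
  apply/subsetP=> x; rewrite !inE => /andP[-> /asboolP ux].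
  exact/asboolP/(vle_trans vu).
have /eqP E : [set x in A | `[< vle u x >]] == [set x in A | `[< vle v x >]].
  by rewrite eqEcard sub /=; apply: umax.
have : v \in [set x in A | `[< vle v x >]].
  by rewrite inE vA; apply/asboolP/vle_refl.
by rewrite -E inE => /andP[_ /asboolP].
Qed.

Lemma thin_max A : thin A -> A != set0 ->
  exists2 u, u \in A & {in A, forall v, vle v u}.
Proof.
case=> cA _ /set0Pn[u0 u0A].
pose f u := #|[set v in A | `[< vle v u >]]|.
case: (arg_maxnP f u0A) => u uA umax; exists u => // v vA.
have [uv|//] := cA u v uA vA.
have sub : [set x in A | `[< vle x u >]] \subset [set x in A | `[< vle x v >]].
  apply/subsetP=> x; rewrite !inE => /andP[-> /asboolP xu].
  exact/asboolP/(vle_trans xu).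
have /eqP E : [set x in A | `[< vle x u >]] == [set x in A | `[< vle x v >]].
  by rewrite eqEcard sub /=; apply: umax.
have : v \in [set x in A | `[< vle x v >]].
  by rewrite inE vA; apply/asboolP/vle_refl.
by rewrite -E inE => /andP[_ /asboolP].
Qed.

End Level.

(** * The flag of a chain *)

Section Flag.
Variables (disp : Order.disp_t) (d : nat) (V : 'I_d -> finOrderType disp).
Local Notation P := {dffun forall i, V i}.
Implicit Types (u v w : P) (A B : {set P}) (i j : 'I_d).

(* Coordinates which rise simultaneously in A are taken in increasing order. *)
Definition before A : rel 'I_d :=
  fun i j => if (i <= j)%N then (i, j) \notin inversions A else (j, i) \in inversions A.

Definition moves A := sort (before A) (enum (moving A)).

Definition raise u w (s : seq 'I_d) : P :=
  [ffun i => if i \in s then w i else u i].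

Definition flag u w (s : seq 'I_d) : {set P} :=
  [set raise u w (take r s) | r : 'I_(size s).+1].

(* For 0 < r < size s this says that s has a descent at r; the default i0 is
   irrelevant there. *)
Definition breakpoint (s : seq 'I_d) r :=
  [\/ r = 0%N, r = size s | forall i0, (nth i0 s r < nth i0 s r.-1)%N].

Definition bounds A u w :=
  [/\ u \in A, w \in A & {in A, forall v, vle u v /\ vle v w}].

Lemma boundsP A : thin A -> A != set0 -> exists u w, bounds A u w.
Proof.
move=> tA A0; have [u uA uP] := thin_min tA A0; have [w wA wP] := thin_max tA A0.
by exists u, w; split=> // v vA; split; [apply: uP|apply: wP].
Qed.

Lemma before_total A : total (before A).
Proof.
move=> i j; rewrite /before; case: ltngtP => [||/ord_inj->].
- by case: (_ \in _).
- by case: (_ \in _).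
- rewrite orbb; apply/negP => /inversionsP[]; by rewrite ltnn.
Qed.

Lemma mem_moves A i : (i \in moves A) = (i \in moving A).
Proof. by rewrite mem_sort mem_enum. Qed.

Lemma moves_uniq A : uniq (moves A).
Proof. by rewrite sort_uniq enum_uniq. Qed.

Lemma flagP u w (s : seq 'I_d) v :
  reflect (exists2 r, (r <= size s)%N & v = raise u w (take r s))
          (v \in flag u w s).
Proof.
apply: (iffP imsetP) => [[r _ ->]|[r rs ->]].
  by exists r => //; rewrite -ltnS ltn_ord.
by exists (Ordinal (rs : (r < (size s).+1)%N)).
Qed.

Lemma raise_nth u w (s : seq 'I_d) i0 r b : uniq s -> (b < size s)%N ->
  raise u w (take r s) (nth i0 s b) =
  if (b < r)%N then w (nth i0 s b) else u (nth i0 s b).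
Proof.
move=> us bs; rewrite ffunE; congr (if _ then _ else _).
apply/(nthP i0)/idP => [[c]|br].
  rewrite size_take_min leq_min => /andP[cr cs]; rewrite nth_take //.
  by move/eqP; rewrite nth_uniq // => /eqP<-.
by exists b; rewrite ?nth_take // size_take_min leq_min br.
Qed.

Variables (A : {set P}) (u w : P).
Hypotheses (tA : thin A) (bA : bounds A u w).

Lemma bound_val v i : v \in A -> v i = u i \/ v i = w i.
Proof.
case: bA => uA wA le vA; have [/(_ i) uv /(_ i) vw] := le v vA.
have [->|ne] := eqVneq (v i) (u i); [by left|right].
have [//|ne'] := eqVneq (v i) (w i); case: tA => _ /(_ _ _ _ uA vA wA i).
by rewrite !lt_neqAle uv vw ne' eq_sym ne => /(_ isT isT).
Qed.

Lemma bound_le i : (u i <= w i)%O.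
Proof. by case: bA => _ wA /(_ w wA)[]. Qed.

Lemma movingE i : (i \in moving A) = (u i < w i)%O.
Proof.
apply/movingP/idP => [[v [v' [vA v'A]]]|uw]; last first.
  by exists u, w; case: bA.
case: bA => _ _ le; have [/(_ i) uv _] := le v vA; have [_ /(_ i) vw] := le v' v'A.
by move=> vv'; apply: le_lt_trans uv (lt_le_trans vv' vw).
Qed.

Lemma moving_neq i : (i \in moving A) = (u i != w i).
Proof. by rewrite movingE lt_neqAle bound_le andbT. Qed.

Lemma inversions_bounds i j : (i, j) \in inversions A <->
  [/\ (i < j)%N, i \in moving A, j \in moving A &
      exists v, [/\ v \in A, v i = u i & v j = w j]].
Proof.
split.
  case/inversionsP=> ij [v1 [v [v2 [v1A vA v2A v1v vv2]]]].
  split=> //; [by apply/movingP; exists v, v2|by apply/movingP; exists v1, v|].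
  exists v; split=> //; case: bA => _ _ le.
    case: (bound_val i vA) => // vi.
    by have [_ /(_ i)] := le _ v2A; rewrite -vi leNgt vv2.
  case: (bound_val j vA) => // vj.
  by have [/(_ j)] := le _ v1A; rewrite -vj leNgt v1v.
case=> ij; rewrite !movingE => mi mj [v [vA vi vj]].
by apply/inversionsP; split=> //; exists u, v, w; case: bA => uA wA _; split; rewrite ?vi ?vj.
Qed.

Let low i := [set v in A | v i == u i].

(** The sets [low i] are initial segments of the chain [A], hence nested, and cardinality compares
    them. *)
Lemma low_sep i j : i \in moving A -> j \in moving A ->
  (exists v, [/\ v \in A, v i = u i & v j = w j]) <-> (#|low j| < #|low i|)%N.
Proof.
rewrite !moving_neq => mi mj; split=> [[v [vA vi vj]]|lt].
  apply/proper_card/properP; split; last first.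
    exists v; rewrite !inE vA ?vi ?eqxx //= vj eq_sym; exact: mj.
  apply/subsetP=> x; rewrite !inE => /andP[xA /eqP xj]; rewrite xA /=.
  have [vx|xv] := tA.1 _ _ vA xA.
    move: mj; rewrite -xj => mj; have := vx j.
    by rewrite vj => wx; have := bound_le j; rewrite -xj le_eqVlt (negbTE mj) ltNge wx.
  have := xv i; rewrite vi; case: bA => _ _ /(_ x xA)[/(_ i) ux _] xu.
  by apply/eqP/le_anti; rewrite ux xu.
have /subsetPn[v] : ~~ (low i \subset low j).
  by apply/negP => /subset_leq_card; rewrite leqNgt lt.
rewrite !inE => /andP[vA /eqP vi]; rewrite vA /= => vj.
by exists v; split=> //; case: (bound_val j vA) => // /eqP; rewrite (negbTE vj).
Qed.

(** On moving coordinates [before] is the lexicographic order of the pairs formed by the moment of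
    rise, measured by [#|low i|], and the index. This makes it transitive. *)
Lemma beforeE i j : i \in moving A -> j \in moving A ->
  before A i j = if (i <= j)%N then (#|low i| <= #|low j|)%N
                 else (#|low i| < #|low j|)%N.
Proof.
move=> mi mj; rewrite /before.
case: (ltngtP i j) => [ij|ji|ij].
- rewrite /= leqNgt; congr (~~ _); apply/idP/idP.
    by move/inversions_bounds=> [_ _ _ /(low_sep mi mj)].
  by move/(low_sep mi mj)=> ?; apply/inversions_bounds.
- apply/idP/idP; first by move/inversions_bounds=> [_ _ _ /(low_sep mj mi)].
  by move/(low_sep mj mi)=> ?; apply/inversions_bounds.
- by rewrite (ord_inj ij) leqnn; apply/negP=> /inversionsP[]; rewrite ltnn.
Qed.

Lemma before_trans : {in moving A & &, transitive (before A)}.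
Proof.
move=> j i k mj mi mk; rewrite !beforeE //.
by case: (leqP i j); case: (leqP j k); case: (leqP i k); lia.
Qed.

Lemma moves_pairwise : pairwise (before A) (moves A).
Proof.
rewrite -(@sorted_pairwise_in _ (mem (moving A))).
- exact/sort_sorted/before_total.
- exact: before_trans.
- by apply/allP=> i; rewrite mem_moves.
Qed.

Lemma moves_before a b i0 : (a <= b)%N -> (b < size (moves A))%N ->
  before A (nth i0 (moves A) a) (nth i0 (moves A) b).
Proof.
rewrite leq_eqVlt => /predU1P[-> _|ab bs]; 
  first by rewrite -[before _ _ _]orbb before_total.
have /(pairwiseP i0) H := moves_pairwise.
by apply: H; rewrite ?inE //; apply: ltn_trans bs.
Qed.

(** The coordinates already risen at [v] are closed downwards under [before], so they form a prefix
    of [moves A]. This characterizes the flag: a point off it that can be added to [A] raises the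
    level. *)
Lemma raise_complete v : thin (v |: A) -> level (v |: A) = level A ->
  exists2 r, (r <= size (moves A))%N & v = raise u w (take r (moves A)).
Proof.
move=> tvA [_ mE iE].
have [uA wA le] := bA; have vvA : v \in v |: A by rewrite setU11.
have sA x : x \in A -> x \in v |: A by exact: setU1r.
have vout i : i \notin moving A -> v i = u i.
  rewrite -mE => mi; apply/eqP; case: ltgtP => // lt; case/negP: mi; apply/movingP.
    by exists v, u; rewrite vvA sA.
  by exists u, v; rewrite vvA sA.
have vin i : i \in moving A -> v i = u i \/ v i = w i.
  rewrite movingE => mi; have [uA' wA'] := (sA _ uA, sA _ wA).
  case: (ltgtP (v i) (u i)) => [lt|gt|->]; [|right|by left].
    by case: (tvA.2 _ _ _ vvA uA' wA' i lt mi).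
  case: (ltgtP (v i) (w i)) => [lt|lt|//].
    by case: (tvA.2 _ _ _ uA' vvA wA' i gt lt).
  by case: (tvA.2 _ _ _ uA' wA' vvA i mi lt).
(* If [i] had not risen at [v], then for [i <= j] the point [v] would create the inversion [(i, j)];
   for [j < i] some [x] in [A] has [i] risen and [j] not, and is incomparable with [v]. *)
have down i j : i \in moving A -> j \in moving A -> before A i j ->
    v j = w j -> v i = w i.
  move=> mi mj bij vj; case: (vin i mi) => // vi.
  move: bij; rewrite /before; case: leqP => [ij|ji].
    rewrite -iE; case/negP; apply/inversionsP; split.
      rewrite ltn_neqAle ij andbT; apply: contraTneq mj => /ord_inj ji.
      by rewrite moving_neq -vj -ji vi negbK.
    by exists u, v, w; rewrite vj vi -!movingE; split=> //; apply: sA.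
  case/inversions_bounds=> _ _ _ [x [xA xj xi]].
  move: mi mj; rewrite !movingE => mi mj.
  by have [/(_ j)|/(_ i)] := tvA.1 _ _ vvA (sA _ xA);
    rewrite (xj, xi) (vj, vi) leNgt (mi, mj).
pose s := moves A; pose r := find (fun i => v i != w i) s.
exists r; first exact: find_size.
apply/ffunP=> i; rewrite ffunE; case: ifPn => [/(nthP i)[a]|].
  rewrite size_take_min => alt; rewrite nth_take; last by apply: leq_trans alt (geq_minl _ _).
  move=> <-; apply/eqP; rewrite -[_ == _]negbK.
  by rewrite (@before_find _ i (fun i => v i != w i)) //; apply: leq_trans alt (geq_minl _ _).
move=> inr; have [mi|] := boolP (i \in moving A); last exact: vout.
have : i \in s by rewrite mem_moves.
case/(nthP i) => b bs bi.
case: (ltnP b r) => [br|rb].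
  case/negP: inr; apply/(nthP i); exists b; last by rewrite nth_take.
  by rewrite size_take_min leq_min br bs.
case: (vin i mi) => // vi; have rs : (r < size s)%N by apply: leq_ltn_trans bs.
have /(nth_find i) : has (fun i => v i != w i) s by rewrite has_find.
rewrite -/r => /eqP[]; apply: (down _ i) => //.
  by rewrite -mem_moves mem_nth.
by rewrite -[X in before _ _ X]bi; apply: moves_before.
Qed.

Lemma raise_in v : v \in A -> v \in flag u w (moves A).
Proof.
move=> vA; have vAA : v |: A = A by apply/setUidPr; rewrite sub1set.
by apply/flagP/raise_complete; rewrite vAA.
Qed.

Lemma raise_val s i : raise u w s i = if i \in s then w i else u i.
Proof. by rewrite ffunE. Qed.

Lemma raise0 : raise u w [::] = u.
Proof. by apply/ffunP=> i; rewrite ffunE. Qed.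

Lemma raise_moves : raise u w (moves A) = w.
Proof.
apply/ffunP=> i; rewrite ffunE mem_moves moving_neq.
by case: eqVneq.
Qed.

Lemma raise_inj r r' : (r <= size (moves A))%N -> (r' <= size (moves A))%N ->
  raise u w (take r (moves A)) = raise u w (take r' (moves A)) -> r = r'.
Proof.
wlog rr' : r r' / (r < r')%N => [W rs rs' E|rs rs' E].
  case: (ltngtP r r') => // lt; first exact: W.
  by apply/esym/W.
have [i0 _] : exists i0 : 'I_d, true.
  by case: (moves A) rs' => [|i0 s _]; [case: r' rr' {E}|exists i0].
have rr : (r < size (moves A))%N by apply: leq_trans rs'.
have := congr1 (fun v : P => v (nth i0 (moves A) r)) E.
rewrite /= !raise_nth ?moves_uniq // ltnn rr' => /eqP.
have : nth i0 (moves A) r \in moving A by rewrite -mem_moves mem_nth.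
by rewrite moving_neq => /negbTE->.
Qed.

Lemma flag_thin B : B \subset flag u w (moves A) -> thin B.
Proof.
move=> /subsetP sB; split=> [x y /sB/flagP[r rs ->] /sB/flagP[r' rs' ->]|].
  wlog rr' : r r' rs rs' / (r <= r')%N => [W|].
    by case: (leqP r r') => [|/ltnW] /W => [|/(_ rs' rs)[]]; auto.
  left=> i; rewrite !raise_val; case: ifPn => [ir|_].
    suff -> : i \in take r' (moves A) by [].
    by move: ir; rewrite -(take_takel _ rr'); apply: mem_take.
  by case: ifP => _; rewrite ?lexx ?bound_le.
move=> x y z /sB/flagP[r _ ->] /sB/flagP[r' _ ->] /sB/flagP[r'' _ ->] i.
rewrite !raise_val; case: (i \in take r' _); case: (i \in take r _);
  case: (i \in take r'' _); rewrite ?ltxx // => l1 l2.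
  by have := lt_trans l1 l2; rewrite ltxx.
by have := lt_trans l1 l2; rewrite ltxx.
Qed.

Lemma flag_level B : B \subset flag u w (moves A) -> level_le B A.
Proof.
move=> /subsetP sB; split.
- by move=> _; apply/set0Pn; exists u; case: bA.
- apply/subsetP=> i /movingP[x [y [/sB/flagP[r _ ->] /sB/flagP[r' _ ->]]]].
  rewrite !raise_val movingE; have := bound_le i.
  by case: (_ \in _); case: (_ \in _); rewrite ?ltxx // leNgt => /negbTE->.
apply/subsetP=> -[i j] /inversionsP[ij [x [y [z []]]]].
move=> /sB/flagP[r _ ->] /sB/flagP[r' rs' ->] /sB/flagP[r'' _ ->].
rewrite !raise_val; have [jr|jr] := boolP (j \in take r' _); last first.
  by case: (j \in _); rewrite /= ?ltxx // ltNge bound_le.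
case: (j \in _); rewrite ?ltxx // => _.
have [_|ir] := boolP (i \in take r' _).
  by case: (i \in _); rewrite /= ?ltxx // ltNge bound_le.
case: (boolP (i \in take r'' _)); rewrite ?ltxx // => /mem_take ir'' _.
case/(nthP i): jr => b; rewrite size_take_min leq_min => /andP[br bs].
rewrite nth_take // => bj.
case/(nthP i): ir'' => a as' ai.
have ra : (r' <= a)%N.
  rewrite leqNgt; apply: contra ir => ar; apply/(nthP i); exists a.
    by rewrite size_take_min leq_min ar.
  by rewrite nth_take.
(* On the flag [j] rises before [i]. Since [i < j], the sorted order permits this only if [(i, j)]
   is an inversion of [A]. *)
have := moves_before i (ltnW (leq_trans br ra)) as'.
by rewrite ai bj /before leqNgt ij.
Qed.

(** A descent at [r] comes from an inversion of [A], so a member of [A] has the move before [r] done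
    and the move at [r] not done. Only the [r]-th point of the flag is like that. *)
Lemma breakpoint_in r : (r <= size (moves A))%N -> breakpoint (moves A) r ->
  raise u w (take r (moves A)) \in A.
Proof.
have [uA wA _] := bA.
move=> rs [->|->|desc]; first by rewrite take0 raise0.
  by rewrite take_size raise_moves.
have [->|r0] := posnP r; first by rewrite take0 raise0.
move: rs; rewrite leq_eqVlt => /predU1P[->|rs]; first by rewrite take_size raise_moves.
have [i0 _] : exists i0 : 'I_d, true by case: (moves A) rs => // i0; exists i0.
have r1s : (r.-1 < size (moves A))%N by apply: leq_ltn_trans rs; apply: leq_pred.
have := moves_before i0 (leq_pred r) rs; rewrite /before leqNgt desc /=.
case/inversions_bounds=> _ _ _ [x [xA x1 x2]].
have /flagP[r' rs' xE] := raise_in xA.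
suff <- : r' = r by rewrite -xE.
move: x1 x2; rewrite xE !raise_nth ?moves_uniq //.
have : nth i0 (moves A) r \in moving A by rewrite -mem_moves mem_nth.
have : nth i0 (moves A) r.-1 \in moving A by rewrite -mem_moves mem_nth.
rewrite !moving_neq => /eqP n1 /eqP n2.
case: ltnP => [|l1]; first by move=> _ /esym.
by case: ltnP => // l2 _ _; lia.
Qed.

(** Removing an interior point that is not a descent keeps both ends, hence the moving coordinates.
    It also keeps every inversion, because the flag descends elsewhere between the two coordinates,
    at another member of [A]. *)
Lemma irredundant_breakpoint r : irredundant A -> (r <= size (moves A))%N ->
  raise u w (take r (moves A)) \in A -> breakpoint (moves A) r.
Proof.
move=> /forall_inP irA rs vA; set v := raise _ _ _ in vA.
have [uA wA _] := bA.
have [->|r0] := eqVneq r 0%N; first by constructor 1.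
have [->|rk] := eqVneq r (size (moves A)); first by constructor 2.
constructor 3 => i0; rewrite ltnNge; apply/negP => nd.
case/negP: (irA v vA); apply/eqP.
have AvA : A :\ v \subset A by rewrite subsetDl.
have uv : u \in A :\ v.
  rewrite !inE uA andbT; apply/eqP; rewrite -raise0 -(take0 (moves A)).
  by move/raise_inj=> /(_ (leq0n _) rs) /esym/eqP; rewrite (negbTE r0).
have wv : w \in A :\ v.
  rewrite !inE wA andbT; apply/eqP; rewrite -{1}raise_moves -{1}(take_size (moves A)).
  by move/raise_inj=> /(_ (leqnn _) rs) /esym/eqP; rewrite (negbTE rk).
rewrite /level; congr (_, _, _).
- by transitivity true; [|symmetry]; apply/set0Pn; exists u.
- apply/eqP; rewrite eqEsubset moving_sub //=; apply/subsetP=> i.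
  by rewrite movingE => lt; apply/movingP; exists u, w.
apply/eqP; rewrite eqEsubset inversions_sub //=; apply/subsetP=> -[i j] ijA.
apply: contraTT (ijA) => nij; apply/negP=> /inversions_bounds[ij].
move=> mi mj [x [xA xi xj]].
have in_inv y : y \in A -> y != v -> y i = u i -> y j = w j -> False.
  move=> yA yv yi yj; case/negP: nij; apply/inversionsP; split=> //.
  exists u, y, w; rewrite yi yj -!movingE; split=> //.
  by rewrite !inE yv.
have [xv|/(in_inv x xA)/(_ xi xj)//] := eqVneq x v.
move: mi mj (mi) (mj); rewrite -{1}mem_moves -{1}[j \in _]mem_moves !moving_neq.
case/(nthP i0)=> b bs bi /(nthP i0)[a as' aj] mi mj.
have rb : (r <= b)%N.
  rewrite leqNgt; apply: contra mi => br.
  by rewrite -xi xv -bi raise_nth ?moves_uniq // br.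
have ar : (a < r)%N.
  rewrite ltnNge; apply: contra mj => ra.
  by rewrite -xj xv -aj raise_nth ?moves_uniq // ltnNge ra.
(* If only [v] witnesses the inversion, the moves never drop from the position [a] of [j] to the
   position [b] of [i]: not at [r] by assumption, and a drop elsewhere would give another witness.
   At [c = b] this contradicts [i < j]. *)
have mono c : (a <= c <= b)%N -> (j <= nth i0 (moves A) c)%N.
  elim: c => [|c IH] /andP[ac cb]; first by move: ac; rewrite leqn0 => /eqP ac; rewrite -ac aj.
  move: ac; rewrite leq_eqVlt => /predU1P[<-|ac]; first by rewrite aj.
  apply: leq_trans (IH _) _; first by rewrite -ltnS ac ltnW.
  have [cr|cr] := eqVneq c.+1 r; first by move: nd; rewrite -cr.
  rewrite leqNgt; apply/negP=> desc.
  have cs : (c.+1 < size (moves A))%N by apply: leq_ltn_trans bs.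
  have yA : raise u w (take c.+1 (moves A)) \in A.
    apply: breakpoint_in; first exact: ltnW.
    by constructor 3 => i1 /=; rewrite !(set_nth_default i0 i1) // ltnW.
  apply: (in_inv _ yA).
  - by apply: contra cr => /eqP E; rewrite (raise_inj (ltnW cs) rs E).
  - by rewrite -bi raise_nth ?moves_uniq // ltnNge cb.
  - by rewrite -aj raise_nth ?moves_uniq // ac.
have := mono b; rewrite bi (leq_trans (ltnW ar) rb) leqnn => /(_ isT).
by rewrite leqNgt ij.
Qed.
End Flag.

(** * Uniqueness of irredundant subsets of a flag *)

Section Unique.
Variables (disp : Order.disp_t) (d : nat) (V : 'I_d -> finOrderType disp).
Local Notation P := {dffun forall i, V i}.

(** Equal levels give the same [moves], and inclusion in the flag gives the same ends. Both sets
    then consist exactly of the breakpoints, by [breakpoint_in] and [irredundant_breakpoint]. *)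
Lemma irredundant_unique (A B : {set P}) u w : thin A -> bounds A u w ->
  irredundant A -> irredundant B -> B \subset flag u w (moves A) -> level B = level A ->
  B = A.
Proof.
move=> tA bA irA irB sBA lBA.
have tB := flag_thin bA sBA.
have [_ mE iE] := lBA.
have B0 : B != set0.
  by case: lBA => -> _ _; apply/set0Pn; exists u; case: bA.
have [u' [w' bB]] := boundsP tB B0.
have sE : moves B = moves A by rewrite /moves /before mE iE.
have inu x i : x \in B -> i \notin moving A -> x i = u i.
  move/(subsetP sBA)/flagP=> [r _ ->]; rewrite raise_val.
  by rewrite (moving_neq bA) negbK => /eqP ->; case: ifP.
have inm i : i \in moving A -> u' i = u i /\ w' i = w i.
  move=> mi; have := mi; rewrite -mE (movingE bB).
  have [/(subsetP sBA)/flagP[r _ ->] /(subsetP sBA)/flagP[r' _ ->] _] := bB.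
  rewrite !raise_val; have := bound_le bA i.
  by case: (i \in _); case: (i \in _); rewrite ?ltxx // leNgt => /negbTE->.
have uE : u' = u.
  apply/ffunP=> i; have [/inm[]//|/inu] := boolP (i \in moving A).
  by apply; case: bB.
have wE : w' = w.
  apply/ffunP=> i; have [/inm[]//|mi] := boolP (i \in moving A).
  have wB : w' \in B by case: bB.
  by rewrite (inu w') //; apply/eqP; rewrite -[_ == _]negbK -(moving_neq bA).
rewrite uE wE in bB.
apply/setP=> v; apply/idP/idP => [vB|vA].
  have /flagP[r rs vE] := raise_in tB bB vB.
  rewrite vE sE; apply: (breakpoint_in tA bA); rewrite -sE //.
  by apply: (irredundant_breakpoint tB bB) => //; rewrite -vE.
have /flagP[r rs vE] := raise_in tA bA vA.
rewrite vE -sE; apply: (breakpoint_in tB bB); rewrite sE //.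
by apply: (irredundant_breakpoint tA bA) => //; rewrite -vE.
Qed.

End Unique.

(** * Simplices as sets of points *)

Lemma all_pairmap (T T' : eqType) (f : T -> T -> T') (Q : pred T') x s :
  {in x :: s &, forall a b, Q (f a b)} -> all Q (pairmap f x s).
Proof.
elim: s x => //= y s IH x H; apply/andP; split.
  by apply: H; rewrite !inE eqxx ?orbT.
by apply: IH => a b aI bI; apply: H; rewrite inE ?aI ?bI orbT.
Qed.

Section SimplexSets.
Variables (disp : Order.disp_t) (d : nat) (V : 'I_d -> finOrderType disp).
Variable G : forall i, graph (V i).
Local Notation P := {dffun forall i, V i}.
Implicit Types (A B : {set P}) (s : seq (vertex G)).

Definition simplex_set A : bool :=
  `[< [/\ thin A, {in A, forall (v : P) i, v i \in vset (G i)} &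
       {in A &, forall (u v : P) i, u i = v i \/ adj (G i) (u i) (v i)}] >].

Lemma simplex_setP A : reflect
  [/\ thin A, {in A, forall (v : P) i, v i \in vset (G i)} &
   {in A &, forall (u v : P) i, u i = v i \/ adj (G i) (u i) (v i)}] (simplex_set A).
Proof. exact: asboolP. Qed.

Lemma simplex_set_sub A B : A \subset B -> simplex_set B -> simplex_set A.
Proof.
move=> sAB /simplex_setP[tB vB aB]; have /subsetP iAB := sAB; apply/simplex_setP; split.
- exact: thin_sub tB.
- by move=> v /iAB; apply: vB.
- by move=> u v /iAB uB /iAB; apply: aB.
Qed.

Lemma simplex_set0 : simplex_set set0.
Proof.
by apply/simplex_setP; split=> [|v|v u]; rewrite ?inE //; split=> v u; rewrite inE.
Qed.

Definition vals s : {set P} := [set v in map val s].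

Lemma moved_const (v : vertex G) s i : path (@one_simplex disp d V G) v s ->
  all (fun J : {set 'I_d} => i \notin J) (pairmap (@moved disp d V G) v s) ->
  {in v :: s, forall x : vertex G, val x i = val v i}.
Proof.
elim: s v => [|y s IH] v /=; first by move=> _ _ x; rewrite inE => /eqP->.
move=> /andP[/forallP/(_ i)/andP[vy _] py] /andP[ni ai].
have yv : val y i = val v i.
  by apply/eqP; move: ni; rewrite inE -leNgt => yv; apply/eqP/le_anti; rewrite yv.
move=> x; rewrite inE => /predU1P[->//|xs].
by rewrite (IH y py ai x xs).
Qed.

Lemma simplex_vals s : simplex s -> simplex_set (vals s).
Proof.
case: s => // v s; rewrite /simplex => /andP[].
suff W : path (@one_simplex disp d V G) v s ->
  pairwise (fun A B : {set 'I_d} => [disjoint A & B])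
     (pairmap (@moved disp d V G) v s) ->
  {in v :: s, forall x : vertex G, vle (val v) (val x)} /\ simplex_set (vals (v :: s)).
  by move=> p q; case: (W p q).
elim: s v => [|w s IH] v.
  move=> _ _; split=> [x|].
    by rewrite inE => /eqP-> i.
  apply/simplex_setP; split.
  - split=> [x y|x y z]; rewrite !inE => /eqP-> /eqP->; first by left=> i.
    by move=> _ i; rewrite ltxx.
  - by move=> x; rewrite !inE => /eqP-> i; apply: (forallP (valP v)).
  - by move=> x y; rewrite !inE => /eqP-> /eqP-> i; left.
move=> /= /andP[vw ps] /andP[dA dP]; have [wle /simplex_setP[[cW tW] vW aW]] := IH w ps dP.
(* By disjointness, a coordinate that rises in the first step is constant afterwards. *)
have stay i x : (val v i < val w i)%O -> x \in vals (w :: s) -> x i = val w i.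
  move=> lt; rewrite inE => /mapP[{}x xs ->].
  apply: (moved_const ps) xs; apply: sub_all dA => B.
  rewrite disjoint_subset => /subsetP/(_ i); rewrite !inE; exact.
have vwle : vle (val v) (val w).
  by move=> i; have /forallP/(_ i)/andP[] := vw.
have vle_all : {in v :: w :: s, forall x : vertex G, vle (val v) (val x)}.
  move=> x; rewrite inE => /predU1P[->|]; first by move=> i.
  by move/wle; apply: vle_trans.
have wI : val w \in vals (w :: s) by rewrite !inE eqxx.
have dich x : x \in vals (v :: w :: s) -> x = val v \/ x \in vals (w :: s).
  by rewrite !inE => /predU1P; case; [left|right].
have vleS x : x \in vals (v :: w :: s) -> vle (val v) x.
  by rewrite inE => /mapP[{}x xs ->]; apply: vle_all.
have adjv x i : x \in vals (w :: s) -> val v i = x i \/ adj (G i) (val v i) (x i).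
  move=> xW; have /forallP/(_ i)/andP[] := vw; rewrite le_eqVlt.
  case/predU1P => [-> _|lt]; first exact: aW.
  rewrite (stay _ _ lt xW) => /predU1P; case; [by left|by right].
split=> //; apply/simplex_setP; split; first split.
- move=> x y xI yI; case/dich: (xI) => [->|xW]; first by left; apply: vleS.
  case/dich: (yI) => [->|yW]; first by right; apply: vleS.
  exact: cW.
- move=> x y z /dich xD /dich[->|yW].
    move=> _ i; rewrite ltNge; case/negP; case: xD => [->//|xW].
    by apply: vleS; move: xW; rewrite !inE => ->; rewrite orbT.
  move=> /dich[->|zW] i xy.
    rewrite ltNge vleS //; by move: yW; rewrite !inE => ->; rewrite orbT.
  case: xD xy => [-> vy|xW xy]; last by apply: tW zW _ xy.
  have := vwle i; rewrite le_eqVlt => /predU1P[vwi|lt].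
    by apply: (tW _ _ _ wI yW zW); rewrite -vwi.
  by rewrite !(stay _ _ lt) // ltxx.
- move=> x /dich[->|xW] i; last exact: vW.
  exact: (forallP (valP v)).
- move=> x y /dich[->|xW] /dich[->|yW] i; [by left|exact: adjv| |exact: aW].
  by case: (adjv x i xW) => [->|]; [left|right; rewrite adj_sym].
Qed.

(** The product order is total on the chain, so sorting gives the sequence. A coordinate rising in
    two of its steps would take three values. *)
Lemma simplex_set_form_simplex s : s != [::] -> simplex_set (vals s) -> form_simplex s.
Proof.
move=> s0 sS; pose le (x y : vertex G) := [forall i, (val x i <= val y i)%O].
have leP x y : reflect (vle (val x) (val y)) (le x y) by apply: forallP.
have valI x : x \in s -> val x \in vals s by move=> xs; rewrite inE map_f.
have tot : {in s &, total le}.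
  move=> x y xs ys; have /simplex_setP[[cS _] _ _] := sS.
  by case: (cS _ _ (valI _ xs) (valI _ ys)) => /leP->; rewrite ?orbT.
have srt := sort_sorted_in tot (allss s).
apply/hasP; exists (sort le s); first by rewrite mem_permutations perm_sort.
have sE : vals (sort le s) = vals s.
  by apply/setP=> x; rewrite !inE; apply/perm_mem/perm_map; rewrite perm_sort.
move: sS; rewrite -sE; have : sort le s != [::].
  by rewrite -size_eq0 size_sort size_eq0.
case: (sort le s) srt => // v t + _ {s s0 valI tot sE}; rewrite /sorted /simplex.
elim: t v => //= w t IH v /andP[vw pt] sS.
have sS' : simplex_set (vals (w :: t)).
  apply: simplex_set_sub sS; apply/subsetP=> x; rewrite !inE => ->; exact: orbT.
have /andP[-> ->] := IH w pt sS'; rewrite !andbT.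
have /simplex_setP[tS _ aS] := sS.
have vI x : x \in v :: w :: t -> val x \in vals (v :: w :: t).
  by move=> xI; rewrite inE map_f.
apply/andP; split.
  apply/forallP=> i; rewrite (leP v w vw) /=; apply/predU1P.
  by apply: aS; apply: vI; rewrite !inE eqxx ?orbT.
have wle : {in w :: t, forall x : vertex G, vle (val w) (val x)}.
  move: pt; rewrite -[path le w t]/(sorted le (w :: t)) sorted_pairwise.
    move=> /= /andP[/allP H _] x; rewrite inE => /predU1P[->|/H/leP //].
    exact: vle_refl.
  by move=> y x z /leP xy /leP yz; apply/leP/(vle_trans xy).
apply: all_pairmap => a b aI bI; rewrite disjoint_subset; apply/subsetP=> i.
rewrite !inE => lt; apply/negP=> lt'.
apply: (tS.2 (val v) (val a) (val b)) lt'; try by apply: vI; rewrite inE (aI, bI, eqxx) ?orbT.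
by apply: lt_le_trans lt (wle a aI i).
Qed.

Lemma form_simplex_set s : form_simplex s -> simplex_set (vals s).
Proof.
case/hasP=> t; rewrite mem_permutations => st /simplex_vals.
by congr simplex_set; apply/setP=> x; rewrite !inE; exact/perm_mem/perm_map.
Qed.

End SimplexSets.

(** * Straightening *)

Lemma mpoly_monom_ind n (K : {mpoly int[n]} -> Prop) :
  (forall p q, K p -> K q -> K (p + q)) -> (forall c p, K p -> K (c *: p)) ->
  (forall l : seq 'I_n, K (\prod_(k <- l) 'X_k)) -> forall p, K p.
Proof.
move=> KD KZ KM; elim/mpolyind => [|c m p _ _ Kp].
  by rewrite -(scale0r (\prod_(k <- [::]) 'X_k)); apply/KZ/KM.
apply: KD => //; apply: KZ; rewrite mpolyXE_id.
suff [l ->] : exists l : seq 'I_n,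
    \prod_(i < n) 'X_i ^+ m i = \prod_(k <- l) ('X_k : {mpoly int[n]}).
  exact: KM.
elim: (index_enum _) => [|k s [l IH]]; first by exists [::]; rewrite !big_nil.
exists (nseq (m k) k ++ l); rewrite big_cons IH big_cat /=; congr (_ * _).
by rewrite big_nseq -Monoid.iteropE.
Qed.

Section Straighten.
Variables (disp : Order.disp_t) (d : nat) (V : 'I_d -> finOrderType disp).
Variable G : forall i, graph (V i).
Local Notation P := {dffun forall i, V i}.
Local Notation T := {mpoly int[d.+1]}.
Implicit Types (A B s : {set P}) (u v w : P) (l : seq P).

(* Indexing the variables by all points, with 0 outside G, lets the products G
   and their subproducts share the same index sets. *)
Definition Cvar v : Zpoly G := if insub v is Some x then C (x : vertex G) else 0.

Lemma Cvar_val (x : vertex G) : Cvar (val x) = C x.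
Proof. by rewrite /Cvar valK. Qed.

Lemma Cvar_out v : ~~ [forall i, v i \in vset (G i)] -> Cvar v = 0.
Proof. by move=> nv; rewrite /Cvar insubN. Qed.

Lemma sum_Cvar (Q : pred P) :
  \sum_(v | Q v) Cvar v = \sum_(x : vertex G | Q (val x)) C x.
Proof.
rewrite (bigID (fun v : P => [forall i, v i \in vset (G i)])) /=.
rewrite [X in _ + X]big1 ?addr0 => [|v /andP[_ /Cvar_out//]].
rewrite (reindex_omap (val : vertex G -> P) insub) => [|v /andP[_ vP]]; last first.
  by rewrite insubT /=.
apply: eq_big => [x|x _]; last by rewrite Cvar_val.
by rewrite valK eqxx andbT (valP x) andbT.
Qed.

Definition monom l : Zpoly G := \prod_(v <- l) Cvar v.

Definition upper A i (a : V i) : bool :=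
  [exists u in A, exists w in A, (u i < w i)%O && (a == w i)].

Lemma upperP A i (a : V i) : reflect
  (exists u w, [/\ u \in A, w \in A, (u i < w i)%O & a = w i]) (upper A a).
Proof.
apply: (iffP exists_inP) => [[u uA /exists_inP[w wA /andP[lt /eqP aw]]]|].
  by exists u, w.
case=> u [w [uA wA lt aw]]; exists u => //; apply/exists_inP; exists w => //.
by rewrite lt aw eqxx.
Qed.

(** The condition [A != set0] does not involve [v]: it switches the whole sum on or off, so that the
    empty simplex contributes only constants. *)
Definition theta_var A (k : 'I_d.+1) : Zpoly G :=
  if unlift ord0 k is Some i then \sum_(v : P | upper A (v i)) Cvar v
  else \sum_(v : P | A != set0) Cvar v.

(* The variable 'X_0 stands for t and 'X_(i.+1) for y_i; those which are
   not available in A are sent to 0. *)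
Definition theta A : T -> Zpoly G := mmap (@mpolyC _ int) (theta_var A).

HB.instance Definition _ A := GRing.RMorphism.copy (theta A)
  (mmap (@mpolyC _ int) (theta_var A)).

Lemma thetaX A k : theta A 'X_k = theta_var A k.
Proof. by rewrite /theta mmapX mmap1U. Qed.

(* A substitute for the ideal generated by the nonfaces (R1) which retains its
   two uses: it lies in the ideal of rational equivalence, and it is killed by
   every morphism to T that kills the nonfaces. *)
Definition sr_zero (p : Zpoly G) : Prop := p \in Defs.Irat G /\
  forall f : {rmorphism Zpoly G -> T},
    (forall A, ~~ simplex_set G A -> exists2 v, v \in A & f (Cvar v) = 0) -> f p = 0.

Lemma sr_zero0 : sr_zero 0.
Proof. by split=> [|f _]; rewrite ?rpred0 ?rmorph0. Qed.

Lemma sr_zeroD p q : sr_zero p -> sr_zero q -> sr_zero (p + q).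
Proof.
move=> [pI fp] [qI fq]; split=> [|f fS]; first exact: rpredD.
by rewrite rmorphD /= fp // fq // addr0.
Qed.

Lemma sr_zeroM a p : sr_zero p -> sr_zero (a * p).
Proof.
move=> [pI fp]; split=> [|f fS]; first exact: idealMr.
by rewrite rmorphM /= fp // mulr0.
Qed.

Lemma sr_zeroZ (c : int) p : sr_zero p -> sr_zero (c *: p).
Proof. by move=> p0; rewrite -mul_mpolyC; apply: sr_zeroM. Qed.

Lemma sr_zero_monom l : ~~ simplex_set G [set v in l] -> sr_zero (monom l).
Proof.
move=> nS; split=> [|f fS]; last first.
  have [v] := fS _ nS; rewrite inE => vl fv.
  by rewrite /monom rmorph_prod /= (big_rem v) //= fv mul0r.
have [/allP lG|/allPn[v vl nv]] := boolP (all (fun v : P => [forall i, v i \in vset (G i)]) l);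
  last by rewrite /monom (big_rem v) //= Cvar_out // mul0r rpred0.
have [s ls] : exists s : seq (vertex G), l = map val s.
  elim: l {nS} lG => [|v l IH] lG; first by exists [::].
  have [|s ->] := IH; first by move=> x xl; apply: lG; rewrite inE xl orbT.
  have vG := lG v (mem_head _ _); by exists (Sub v vG :: s).
rewrite /monom ls big_map (eq_bigr C) => [|x _]; last by rewrite Cvar_val.
apply/rat_gen_Irat/Rat1.
  apply: contraNneq nS => s0; rewrite ls s0 (_ : [set v in _] = set0).
    exact: simplex_set0.
  by apply/setP=> v; rewrite !inE.
by apply: contra nS => /form_simplex_set; rewrite ls.
Qed.

Definition good_set A := simplex_set G A && irredundant A.

Definition sqfree A : Zpoly G := \prod_(v in A) Cvar v.

Definition comb (q : {set P} -> T) := \sum_(s | good_set s) sqfree s * theta s (q s).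

(* Every theta_A-multiple of sqfree s is then a theta_s-multiple. *)
Definition extends A s := (A != set0 -> s != set0) /\
  forall i, i \in moving A ->
    i \in moving s /\ forall a : V i, upper A a = upper s a.

Lemma extends_refl A : extends A A.
Proof. by []. Qed.

Lemma extends_trans A B s : extends A B -> extends B s -> extends A s.
Proof.
move=> [nAB eAB] [nBs eBs]; split=> [/nAB/nBs//|i /eAB[/eBs[mi us] uB]].
by split=> // a; rewrite uB us.
Qed.

Lemma extends_sub A B : A \subset B -> thin B -> extends A B.
Proof.
move=> sAB tB; split=> [|i mi]; first by case: (level_le_sub sAB).
split; first by move: mi; apply/subsetP/moving_sub.
have /subsetP iAB := sAB.
move=> a; apply/upperP/upperP => -[u [w [uA wA lt aw]]].
  by exists u, w; split=> //; apply: iAB.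
have /movingP[u' [w' [u'A w'A lt']]] := mi.
exists u', w'; split=> //; have u'B := iAB _ u'A; have w'B := iAB _ w'A.
rewrite aw; case: (ltgtP (w i) (w' i)) => // lt2.
  case: (ltgtP (u' i) (w i)) => [lt3|lt3|eq3].
  - by case: (tB.2 _ _ _ u'B wA w'B i lt3 lt2).
  - by case: (tB.2 _ _ _ uA wA u'B i lt lt3).
  - by case: (tB.2 _ _ _ uA u'B w'B i) => //; rewrite eq3.
by case: (tB.2 _ _ _ u'B w'B wA i lt' lt2).
Qed.

Lemma extends_level A B : A \subset B -> thin B -> level A = level B -> extends B A.
Proof.
move=> sAB tB [n0 mE _]; split; first by rewrite n0.
move=> i; rewrite -mE => mi; split=> // a.
by case: (extends_sub sAB tB) => _ /(_ i mi)[_ ->].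
Qed.

Definition active A (k : 'I_d.+1) : bool :=
  if unlift ord0 k is Some i then i \in moving A else A != set0.

Lemma theta_extends A s k : extends A s -> active A k -> theta s 'X_k = theta A 'X_k.
Proof.
case=> n0 e; rewrite /active !thetaX /theta_var.
case: unliftP => [i _ /e[_ us]|_ A0]; last by rewrite A0 n0.
by apply: eq_bigl => v; rewrite us.
Qed.

(** Keeping track of the sets [s] that occur makes the predicate stable under multiplication by the
    active variables of [A], as these have one value for all such [s]. *)
Definition straight A p := exists q : {set P} -> T,
  (forall s, q s != 0 -> extends A s) /\ sr_zero (p - comb q).

Lemma combD q r : comb (fun s => q s + r s) = comb q + comb r.
Proof.
by rewrite -big_split /=; apply: eq_bigr => s _; rewrite rmorphD mulrDr.
Qed.

Lemma combZ (c : int) q : comb (fun s => c *: q s) = c *: comb q.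
Proof.
rewrite scaler_sumr; apply: eq_bigr => s _.
by rewrite -!mul_mpolyC rmorphM /= [theta s _%:MP]mmapC mulrCA.
Qed.

Lemma comb0 : comb (fun=> 0) = 0.
Proof. by rewrite /comb big1 // => s _; rewrite rmorph0 mulr0. Qed.

Lemma straight_sr_zero A p : sr_zero p -> straight A p.
Proof. by move=> p0; exists (fun=> 0); split=> [s|]; rewrite ?eqxx // comb0 subr0. Qed.

Lemma straightD A p p' : straight A p -> straight A p' -> straight A (p + p').
Proof.
move=> [q [qe qs]] [q' [qe' qs']]; exists (fun s => q s + q' s); split=> [s|].
  have [->|/qe//] := eqVneq (q s) 0; rewrite add0r; exact: qe'.
by rewrite combD opprD addrACA; exact: sr_zeroD qs qs'.
Qed.

Lemma straightZ A (c : int) p : straight A p -> straight A (c *: p).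
Proof.
move=> [q [qe qs]]; exists (fun s => c *: q s); split=> [s|].
  have [->|/qe//] := eqVneq (q s) 0; by rewrite scaler0 eqxx.
by rewrite combZ -scalerBr; apply: sr_zeroZ.
Qed.

Lemma straight_extends A B p : extends A B -> straight B p -> straight A p.
Proof.
by move=> eAB [q [qe qs]]; exists q; split=> // s /qe; apply: extends_trans.
Qed.

Lemma comb_mulX A k q : active A k -> (forall s, q s != 0 -> extends A s) ->
  comb (fun s => 'X_k * q s) = theta A 'X_k * comb q.
Proof.
move=> aA qe; rewrite /comb mulr_sumr; apply: eq_bigr => s _.
have [->|/qe eAs] := eqVneq (q s) 0; first by rewrite mulr0 rmorph0 !mulr0.
by rewrite rmorphM /= (theta_extends eAs aA) mulrCA.
Qed.

Lemma straight_mulX A k p : active A k -> straight A p -> straight A (theta A 'X_k * p).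
Proof.
move=> aA [q [qe qs]]; exists (fun s => 'X_k * q s); split=> [s|].
  by have [->|/qe//] := eqVneq (q s) 0; rewrite mulr0 eqxx.
by rewrite (comb_mulX aA qe) -mulrBr; apply: sr_zeroM.
Qed.

(* The functions t >= y_(s_1) >= ... >= y_(s_k) >= 0 on the cone over the flag of
   s; the default value of nth supplies the last one. *)
Definition heights (s : seq 'I_d) : seq T := 'X_ord0 :: [seq 'X_(lift ord0 i) | i <- s].

(** The range of summation of the [r]-th entry of [heights]: all points for [r = 0], none past the
    last move. *)
Definition above A r v : bool :=
  nth false (true :: [seq upper A (v i) | i <- moves A]) r.

Lemma theta_height A r : A != set0 ->
  theta A (heights (moves A))`_r = \sum_(v | above A r v) Cvar v.
Proof.
move=> A0; case: r => [|r] /=; first by rewrite thetaX /theta_var unlift_none A0.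
rewrite /above /=; case: (ltnP r (size (moves A))) => rs; last first.
  rewrite nth_default ?size_map // rmorph0 big_pred0 // => v.
  by rewrite nth_default // size_map.
have [i0 _] : exists i0 : 'I_d, true by case: (moves A) rs => // i0; exists i0.
rewrite (nth_map i0) // thetaX /theta_var liftK.
by apply: eq_bigl => v; rewrite (nth_map i0).
Qed.

Lemma straight_mul_height A r p : A != set0 -> straight A p ->
  straight A (theta A (heights (moves A))`_r * p).
Proof.
move=> A0 Rp; case: r => [|r] /=.
  by apply: straight_mulX => //; rewrite /active unlift_none.
case: (ltnP r (size (moves A))) => rs; last first.
  by rewrite nth_default ?size_map // rmorph0 mul0r; apply/straight_sr_zero/sr_zero0.
have [i0 _] : exists i0 : 'I_d, true by case: (moves A) rs => // i0; exists i0.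
rewrite (nth_map i0) //; apply: straight_mulX => //.
by rewrite /active liftK -mem_moves mem_nth.
Qed.

Lemma upper_bounds A u w i (a : V i) : thin A -> bounds A u w ->
  i \in moving A -> upper A a = (a == w i).
Proof.
move=> tA bA mi; apply/upperP/eqP => [[x [y [xA yA lt ->]]]|->]; last first.
  by exists u, w; case: (bA) => uA wA _; rewrite -(movingE bA).
case: (bound_val tA bA i yA) => // yu; move: lt; rewrite yu ltNge.
by case: bA => _ _ /(_ x xA)[/(_ i) ->].
Qed.

Lemma above_flag A u w r r' : thin A -> bounds A u w ->
  (r <= (size (moves A)).+1)%N -> (r' <= size (moves A))%N ->
  above A r (raise u w (take r' (moves A))) = (r <= r')%N.
Proof.
move=> tA bA; case: r => [//|r]; rewrite ltnS leq_eqVlt => /predU1P[->|rs] rs'.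
  by rewrite /above /= nth_default ?size_map // ltnNge rs'.
have [i0 _] : exists i0 : 'I_d, true by case: (moves A) rs => // i0; exists i0.
have mi : nth i0 (moves A) r \in moving A by rewrite -mem_moves mem_nth.
rewrite /above /= (nth_map i0) // (upper_bounds _ tA bA) //.
rewrite raise_nth ?moves_uniq //; case: ifP => _; rewrite ?eqxx //.
by apply/negbTE; rewrite -(moving_neq bA).
Qed.

(** Along the flag, the range of the height [r] contains exactly one point more than that of the
    height [r.+1]; the last sum removes the contribution of the points off the flag. *)
Lemma flag_form A u w r : thin A -> bounds A u w -> (r <= size (moves A))%N ->
  Cvar (raise u w (take r (moves A))) =
  theta A (heights (moves A))`_r - theta A (heights (moves A))`_r.+1 -
  \sum_(v | v \notin flag u w (moves A))
     ((above A r v)%:R - (above A r.+1 v)%:R) *: Cvar v.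
Proof.
move=> tA bA rs; have A0 : A != set0 by apply/set0Pn; exists u; case: bA.
rewrite !theta_height // ![\sum_(v | above _ _ v) _]big_mkcond -sumrB /=.
rewrite [X in X - _](bigID (fun v => v \in flag u w (moves A))) /=.
set x := raise _ _ _.
rewrite (bigD1 x) /=; last by apply/flagP; exists r.
rewrite [X in _ + X + _]big1 => [|v /andP[/flagP[r' rs' ->] ne]]; last first.
  rewrite !(above_flag tA bA) ?(leqW rs) // ltn_neqAle.
  have -> : (r == r') = false by apply: contraNF ne => /eqP <-.
  by case: (_ <= _)%N; rewrite /= subrr.
rewrite /x !(above_flag tA bA) ?(leqW rs) // leqnn ltnn /= subr0 addr0.
rewrite [X in _ = _ + X - _](_ : _ = \sum_(v | v \notin flag u w (moves A))
     ((above A r v)%:R - (above A r.+1 v)%:R) *: Cvar v) ?addrK //.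
apply: eq_bigr => v _; rewrite scalerBl; congr (_ - _).
  by case: (above A r v); rewrite ?scale1r ?scale0r.
by case: (above A r.+1 v); rewrite ?scale1r ?scale0r.
Qed.

Lemma sqfree_monom l : uniq l -> sqfree [set v in l] = monom l.
Proof.
by move=> ul; rewrite /sqfree /monom big_set -big_uniq.
Qed.

(** Either a point is repeated, and dropping one copy leaves the support unchanged, or the support
    itself is redundant. *)
Lemma redundant l : ~~ (uniq l && irredundant [set v in l]) ->
  exists2 v, v \in l & level [set x in rem v l] = level [set x in l].
Proof.
have [ul /=|nul _] := boolP (uniq l).
  rewrite negb_forall_in => /exists_inP[v vl]; rewrite negbK => /eqP E.
  exists v; first by move: vl; rewrite inE.
  rewrite -E; congr level; apply/setP=> x; rewrite !inE mem_rem_uniq //.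
have [v vl vr] : exists2 v, v \in l & v \in rem v l.
  elim: l nul => //= x l IH; rewrite negb_and negbK => /orP[xl|/IH[v vl vr]].
    by exists x; rewrite ?mem_head // eqxx.
  by exists v; rewrite ?inE ?vl ?orbT //; case: eqP; rewrite // inE vr orbT.
exists v => //; congr level; apply/setP=> x.
by rewrite !inE (perm_mem (perm_to_rem vl)) inE; case: eqP => [->|].
Qed.

(* By induction on the degree and, in a fixed degree, downwards on the weight of
   the support. *)
Lemma straight_monom l : straight [set v in l] (monom l).
Proof.
(* [N] exceeds every weight, so the measure below decreases whenever the degree drops, and in a
   fixed degree whenever the weight rises. *)
pose N := (2 + d + d * d)%N.
have wle B : (weight B < N)%N by rewrite ltnS; apply: weight_bound.
clearbody N; have [n] := ubnP (size l * N + (N - weight [set v in l]))%N.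
elim: n l => // n IH l; rewrite ltnS => ln.
have [lS|/sr_zero_monom] := boolP (simplex_set G [set v in l]); last exact: straight_sr_zero.
have [/andP[ul irl]|] := boolP (uniq l && irredundant [set v in l]).
  set A := [set v in l]; exists (fun s => (s == A)%:R); split=> [s|].
    by have [->|] := eqVneq s A; rewrite ?eqxx // => _; apply: extends_refl.
  rewrite /comb (bigD1 A) /=; last by rewrite /good_set lS.
  rewrite eqxx rmorph1 mulr1 sqfree_monom // big1 ?addr0 ?subrr; first exact: sr_zero0.
  by move=> s /andP[_ /negbTE->]; rewrite rmorph0 mulr0.
case/redundant => v vl; set l' := rem v l; set A := [set x in l'].
move=> lE; have sAl : A \subset [set x in l].
  by apply/subsetP=> x; rewrite !inE; apply: mem_rem.
have [tl _ _] := simplex_setP _ _ lS.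
have tA := thin_sub sAl tl.
apply: (straight_extends (extends_level sAl tl lE)).
have vA : v |: A = [set x in l].
  apply/setP=> x; rewrite !inE -/l' (perm_mem (perm_to_rem vl)) inE; done.
have A0 : A != set0.
  have [-> _ _] := lE; by apply/set0Pn; exists v; rewrite inE.
have [u [w bA]] := boundsP tA A0.
(* Putting [v] back does not change the level, so [v] lies on the flag of [A]. *)
have [r rs vE] : exists2 r, (r <= size (moves A))%N & v = raise u w (take r (moves A)).
  by apply: raise_complete => //; rewrite vA.
have sl : size l = (size l').+1.
  by rewrite (perm_size (perm_to_rem vl)).
have Rl' : straight A (monom l').
  by apply: IH; move: (wle A) (wle [set x in l]) ln; rewrite sl mulSn -/A;
    move: (size l' * N)%N (weight _) (weight _); lia.
have -> : monom l = Cvar v * monom l' by rewrite /monom (big_rem v).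
rewrite vE (flag_form tA bA rs) mulrBl mulr_suml.
apply: straightD.
  by rewrite mulrBl -[- _]scaleN1r; apply: straightD; [|apply: straightZ];
    apply: straight_mul_height.
rewrite -scaleN1r; apply: straightZ; apply: (big_ind (straight A)) => [||x xn].
- exact/straight_sr_zero/sr_zero0.
- exact: straightD.
rewrite -scalerAl; apply: straightZ.
rewrite [_ * _](_ : _ = monom (x :: l')); last by rewrite /monom big_cons.
have [xS|/sr_zero_monom] := boolP (simplex_set G [set v in x :: l']);
  last exact: straight_sr_zero.
have xA : [set v in x :: l'] = x |: A by apply/setP=> y; rewrite !inE.
have [txA _ _] := simplex_setP _ _ xS.
have sxA : A \subset [set v in x :: l'] by rewrite xA subsetUr.
apply: (straight_extends (extends_sub sxA txA)); apply: IH.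
(* As [x] is off the flag, adding it raises the level: the degree is that of [l], but the weight is
   larger. *)
have lt : (weight A < weight [set v in x :: l'])%N.
  apply: level_le_weight; first exact: level_le_sub.
  move=> E; case/negP: xn; apply/flagP/(raise_complete tA bA); rewrite -xA //.
have wE : weight A = weight [set x in l].
  by rewrite /weight; case: lE => -> -> ->.
by move: (wle [set v in x :: l']) ln lt; rewrite wE sl /= !mulSn;
  move: (size l' * N)%N (weight _) (weight _); lia.
Qed.

End Straighten.

(** * The basis of the Chow ring *)

Lemma rmorph_mpoly_eq n (R : comNzRingType) (f g : {rmorphism {mpoly int[n]} -> R}) :
  (forall k, f 'X_k = g 'X_k) -> f =1 g.
Proof.
move=> fg; apply: mpoly_monom_ind => [p q fp fq|c p fp|l].
- by rewrite !rmorphD fp fq.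
- by rewrite -[c]intz scaler_int !rmorphMz fp.
- by rewrite !rmorph_prod; apply: eq_bigr.
Qed.

Lemma mpolyX_inj n : injective (fun k : 'I_n => 'X_k : {mpoly int[n]}).
Proof.
move=> i j /(congr1 (meval (fun k => (k == i)%:R))).
by rewrite /= !mevalXU eqxx; case: eqVneq.
Qed.

Lemma mpolyXU_neq0 n (k : 'I_n) : 'X_k != 0 :> {mpoly int[n]}.
Proof.
apply/eqP => /(congr1 (meval (fun=> 1))).
by rewrite mevalXU meval0.
Qed.

Section Basis.
Variables (disp : Order.disp_t) (d : nat) (V : 'I_d -> finOrderType disp).
Variable G : forall i, graph (V i).
Local Notation P := {dffun forall i, V i}.
Local Notation T := {mpoly int[d.+1]}.
Local Notation Cvar := (@Cvar disp d V G).
Local Notation theta := (@theta disp d V G).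
Local Notation sqfree := (@sqfree disp d V G).
Implicit Types (A B s : {set P}) (u v w : P) (l : seq P).

Definition active_var A (k : 'I_d.+1) : T := if active A k then 'X_k else 0.

(** The projection of [T] onto the polynomials in the active variables of [A], through which
    [theta A] factors. *)
Definition activate A : T -> T := mmap (@mpolyC _ int) (active_var A).

HB.instance Definition _ A := GRing.RMorphism.copy (activate A)
  (mmap (@mpolyC _ int) (active_var A)).

Lemma activateX A k : activate A 'X_k = active_var A k.
Proof. by rewrite /activate mmapX mmap1U. Qed.

Lemma theta_inactive A k : ~~ active A k -> theta A 'X_k = 0.
Proof.
rewrite thetaX /active /theta_var; case: unliftP => [i _ ni|_ /negbTE->].
  apply: big_pred0 => v; apply: contraNF ni => /upperP[u [w [uA wA lt _]]].
  by apply/movingP; exists u, w.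
by rewrite big_pred0.
Qed.

Lemma theta_activate A q : theta A (activate A q) = theta A q.
Proof.
apply: (rmorph_mpoly_eq (f := theta A \o activate A)) => k /=.
rewrite activateX /active_var; case: ifPn => [//|nk].
by rewrite theta_inactive // rmorph0.
Qed.

Definition const_term (q : T) : int := q.@[fun=> 0].

HB.instance Definition _ := GRing.RMorphism.copy const_term (meval (fun=> 0)).

Lemma const_termX k : const_term 'X_k = 0.
Proof. exact: mevalXU. Qed.

Lemma const_term_activate A q : const_term (activate A q) = const_term q.
Proof.
apply: (rmorph_mpoly_eq (f := const_term \o activate A)) => k /=.
by rewrite activateX /active_var; case: ifP => // _; rewrite const_termX rmorph0.
Qed.

(** * Evaluation on flags and independence *)

Definition subst_var (h : P -> T) (k : 'I_#|{: vertex G}|) : T := h (val (enum_val k)).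

Definition subst (h : P -> T) : Zpoly G -> T := mmap (@mpolyC _ int) (subst_var h).

HB.instance Definition _ h := GRing.RMorphism.copy (subst h)
  (mmap (@mpolyC _ int) (subst_var h)).

Lemma subst_Cvar h v : (~~ [forall i, v i \in vset (G i)] -> h v = 0) ->
  subst h (Cvar v) = h v.
Proof.
move=> h0; have [vG|nv] := boolP [forall i, v i \in vset (G i)]; last first.
  by rewrite Cvar_out // rmorph0 h0.
rewrite -[v]/(val (Sub v vG : vertex G)) Cvar_val /subst /Defs.C mmapX mmap1U.
by rewrite /subst_var enum_rankK.
Qed.

(** The barycentric coordinate of the [r]-th flag point; for the last point the subtracted entry is
    the default 0. *)
Definition height_diff s r := (heights (moves s))`_r - (heights (moves s))`_r.+1.

Lemma height_diff_neq0 s r : (r <= size (moves s))%N -> height_diff s r != 0.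
Proof.
move=> rs; rewrite /height_diff subr_eq0.
have gu : uniq (heights (moves s)).
  rewrite /heights /= map_inj_uniq ?moves_uniq; last first.
    by move=> i j /mpolyX_inj/lift_inj.
  by rewrite andbT; apply/mapP=> -[i _ /mpolyX_inj/eqP]; rewrite (negbTE (neq_lift _ _)).
have gs : size (heights (moves s)) = (size (moves s)).+1 by rewrite /= size_map.
move: rs; rewrite leq_eqVlt => /predU1P[rE|rs]; last first.
  by rewrite nth_uniq ?gs ?ltnS // ?(ltnW rs) // ltn_eqF.
rewrite [X in _ != X]nth_default; last by rewrite gs rE.
have: (heights (moves s))`_r \in heights (moves s) by rewrite mem_nth // gs rE.
by rewrite inE => /predU1P[->|/mapP[i _ ->]]; apply: mpolyXU_neq0.
Qed.

(* Restriction to the flag of s, in the coordinates t, y_i of the cone over it. *)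
Definition flag_map s (psi : {rmorphism Zpoly G -> T}) :=
  [/\ forall A, ~~ simplex_set G A -> exists2 v, v \in A & psi (Cvar v) = 0,
      forall q, psi (theta s q) = activate s q,
      psi (sqfree s) != 0 &
      forall s', good_set G s' -> psi (sqfree s') != 0 ->
        s' = s \/ (weight s' < weight s)%N].

Lemma flag_map0 : exists psi, flag_map set0 psi.
Proof.
exists (subst (fun=> 0)); have C0 v : subst (fun=> 0) (Cvar v) = 0 by rewrite subst_Cvar.
split.
- move=> A nA; have /set0Pn[v vA] : A != set0; last by exists v; last exact: C0.
  by apply: contraNneq nA => ->; apply: simplex_set0.
- move=> q; apply: (rmorph_mpoly_eq (f := subst (fun=> 0) \o theta set0)) => k /=.
  have nk : ~~ active (set0 : {set P}) k.
    rewrite /active; case: unliftP => [i _|_]; last by rewrite eqxx.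
    by apply/movingP=> -[u [w []]]; rewrite inE.
  by rewrite theta_inactive // activateX /active_var (negbTE nk) rmorph0.
- by rewrite /sqfree big_set0 rmorph1 oner_eq0.
move=> s' _; have [->|/set0Pn[v vs]] := eqVneq s' set0; first by left.
by rewrite /sqfree (big_setD1 v vs) /= rmorphM /= C0 mul0r eqxx.
Qed.

(** Each flag point is sent to its barycentric coordinate and every other point to 0. Telescoping
    then recovers the heights, so [theta s] is inverted on the active variables. *)
Lemma flag_map_exists s : good_set G s -> exists psi, flag_map s psi.
Proof.
case/andP=> sS sI; have [->|s0] := eqVneq s set0; first exact: flag_map0.
have [ts vs as_] := simplex_setP _ _ sS; have [u [w bs]] := boundsP ts s0.
pose m := moves s; pose fl r := raise u w (take r m).
(* At most one [r] contributes, since the flag points are distinct. *)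
pose h v := \sum_(r < (size m).+1 | v == fl r) height_diff s r.
have hfl r : (r <= size m)%N -> h (fl r) = height_diff s r.
  move=> rm; rewrite /h (bigD1 (Ordinal (rm : (r < (size m).+1)%N))) //=.
  rewrite big1 ?addr0 // => -[r' r'm] /andP[/eqP/(raise_inj bs rm r'm) E].
  by case/eqP; apply: val_inj; rewrite /= E.
have hout v : v \notin flag u w m -> h v = 0.
  move=> nv; apply: big_pred0 => r; apply: contraNF nv => /eqP->.
  by apply/flagP; exists r => //; rewrite -ltnS ltn_ord.
have flS : simplex_set G (flag u w m).
  have [uA wA _] := bs; apply/simplex_setP; split.
  - exact: (flag_thin bs).
  - by move=> v /flagP[r _ ->] i; rewrite raise_val; case: ifP => _; apply: vs.
  move=> x y /flagP[r _ ->] /flagP[r' _ ->] i; rewrite !raise_val.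
  by case: ifP; case: ifP => _ _; apply: as_.
have hC v : subst h (Cvar v) = h v.
  apply: subst_Cvar => nv; apply: hout; apply: contra nv => vf.
  by have [_ H _] := simplex_setP _ _ flS; apply/forallP; apply: H.
have sum_fl a : (a <= size m)%N -> \sum_(v | above s a v) h v = (heights m)`_a.
  move=> am; rewrite /h (exchange_big_dep xpredT) //=.
  transitivity (\sum_(r < (size m).+1 | (a <= r)%N) height_diff s r).
    rewrite [RHS]big_mkcond /=; apply: eq_bigr => r _.
    have rm : (r <= size m)%N by rewrite -ltnS.
    have aE : above s a (fl r) = (a <= r)%N by apply: (above_flag ts bs) => //; apply: leqW.
    rewrite -aE; case: ifP => ar; last first.
      by apply: big_pred0 => v; apply: contraFF ar => /andP[+ /eqP <-].
    by rewrite (big_pred1 (fl r)) // => v; rewrite /=; case: eqP => [->|_]; rewrite ?ar ?andbF.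
  rewrite -(big_geq_mkord a _ (fun=> true)).
  rewrite (eq_bigr (fun r => - ((heights m)`_r.+1 - (heights m)`_r))) => [|r _];
    last by rewrite opprB.
  rewrite sumrN telescope_sumr ?leqW // opprB.
  by rewrite [X in _ - X]nth_default ?subr0 //= size_map.
have psi_height a : (a <= size m)%N -> subst h (theta s (heights m)`_a) = (heights m)`_a.
  move=> am; rewrite theta_height // rmorph_sum /= -sum_fl //.
  by apply: eq_bigr => v _; rewrite hC.
exists (subst h); split.
- move=> A nA; have /subsetPn[v vA nv] : ~~ (A \subset flag u w m).
    by apply: contra nA => /simplex_set_sub; apply.
  by exists v => //; rewrite /= hC hout.
- move=> q; apply: (rmorph_mpoly_eq (f := subst h \o theta s)) => k /=.
  rewrite activateX /active_var; case: ifPn => [|nk];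
    last by rewrite theta_inactive // rmorph0.
  rewrite /active; case: unliftP => [i ->|-> _]; last exact: (psi_height 0%N).
  rewrite -mem_moves -/m => /(nthP i)[a am ai].
  by have := psi_height _ am; rewrite /= (nth_map i) // ai.
- rewrite /sqfree rmorph_prod; apply/prodf_neq0 => v /(raise_in ts bs)/flagP[r rm ->].
  by rewrite /= hC hfl // height_diff_neq0.
move=> s' /andP[s'S s'I] ns'.
(* A surviving monomial is supported on the flag, so its level is at most that of [s]; equality
   identifies it with [s]. *)
have sub : s' \subset flag u w m.
  apply/subsetP=> v vs'; apply: contraNT ns' => nv.
  by rewrite /sqfree (big_setD1 v vs') /= rmorphM /= hC hout // mul0r.
have [lE|/eqP nE] := eqVneq (level s') (level s); last first.
  by right; apply: level_le_weight nE; apply: flag_level sub.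
by left; exact: (irredundant_unique ts bs sI s'I sub lE).
Qed.

(** The flag maps are triangular for the weight. Once the terms of smaller weight vanish, the map at
    [s] leaves a product in an integral domain whose first factor is nonzero. The induction needs
    all of [theta s (q s)] to vanish, not only its constant term. *)
Lemma sr_zero_comb q : sr_zero (comb G q) -> forall s, good_set G s -> const_term (q s) = 0.
Proof.
case=> _ cq.
suff H s : good_set G s -> theta s (q s) = 0 /\ const_term (q s) = 0 by move=> s /H[].
have [n] := ubnP (weight s); elim: n s => // n IH s; rewrite ltnS => sn gs.
have [psi [pS pT pb pL]] := flag_map_exists gs.
have := cq psi pS; rewrite /comb rmorph_sum /= (bigD1 s) //= big1 ?addr0; last first.
  move=> s' /andP[gs' ne]; rewrite rmorphM /=.
  have [->|nz] := eqVneq (psi (sqfree s')) 0; first by rewrite mul0r.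
  case: (pL s' gs' nz) => [E|lt]; first by rewrite E eqxx in ne.
  by have [->] := IH s' (leq_trans lt sn) gs'; rewrite rmorph0 mulr0.
rewrite rmorphM /= pT => /eqP; rewrite mulf_eq0 (negbTE pb) /= => /eqP a0.
by rewrite -theta_activate -(const_term_activate s) a0 !rmorph0.
Qed.

(* The theta-coefficients lie in the ideal generated by theta; this turns out to
   be the ideal of rational equivalence. *)
Definition straight0 (p : Zpoly G) := exists q : {set P} -> T,
  (forall s, const_term (q s) = 0) /\ sr_zero (p - comb G q).

Lemma straight0_sr_zero p : sr_zero p -> straight0 p.
Proof. by move=> p0; exists (fun=> 0); split=> [s|]; rewrite ?rmorph0 // comb0 subr0. Qed.

Lemma straight0D p p' : straight0 p -> straight0 p' -> straight0 (p + p').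
Proof.
move=> [q [qe qs]] [q' [qe' qs']]; exists (fun s => q s + q' s); split=> [s|].
  by rewrite rmorphD /= qe qe'.
by rewrite (combD G q q') opprD addrACA; exact: sr_zeroD qs qs'.
Qed.

Lemma straight0Z (c : int) p : straight0 p -> straight0 (c *: p).
Proof.
move=> [q [qe qs]]; exists (fun s => c *: q s); split=> [s|].
  by rewrite -mul_mpolyC rmorphM /= qe mulr0.
by rewrite (combZ G c q) -scalerBr; exact: sr_zeroZ qs.
Qed.

Lemma straight0_mulX A k p : active A k -> straight A p -> straight0 (theta A 'X_k * p).
Proof.
move=> aA [q [qe qs]]; exists (fun s => 'X_k * q s); split=> [s|].
  by rewrite rmorphM /= const_termX mul0r.
by rewrite (comb_mulX G aA qe) -mulrBr; exact: sr_zeroM.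
Qed.

Lemma upper_thin A x y i (a : V i) : thin A -> x \in A -> y \in A ->
  (x i < y i)%O -> upper A a = (a == y i).
Proof.
move=> tA xA yA lt; have A0 : A != set0 by apply/set0Pn; exists x.
have [u [w bA]] := boundsP tA A0.
have mi : i \in moving A by apply/movingP; exists x, y.
rewrite (upper_bounds _ tA bA mi); congr (_ == _); apply/esym/eqP.
by rewrite -(upper_bounds _ tA bA mi); apply/upperP; exists x, y.
Qed.

(* If x i is the lower value, then the sum in (R3) is t - y_i up to vertices which
   have a third value at i. *)
Lemma straight0_rat3 l (x y : vertex G) i : val x i != val y i ->
  straight0 (monom G (val x :: val y :: l) * \sum_(v : P | v i == val x i) Cvar v).
Proof.
move=> ne; set l' := _ :: _; set A := [set v in l'].
have [lS|/sr_zero_monom l0] := boolP (simplex_set G A);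
  last by rewrite mulrC; apply/straight0_sr_zero/sr_zeroM.
have [tA _ _] := simplex_setP _ _ lS.
have xA : val x \in A by rewrite !inE eqxx.
have yA : val y \in A by rewrite !inE eqxx orbT.
have RA := straight_monom G l'.
have act0 : active A ord0.
  by rewrite /active unlift_none; apply/set0Pn; exists (val x).
have mi : active A (lift ord0 i).
  rewrite /active liftK; apply/movingP.
  by case: (ltgtP (val x i) (val y i)) ne => // lt _;
    [exists (val x), (val y)|exists (val y), (val x)].
have thE z z' : z \in A -> z' \in A -> (z i < z' i)%O ->
    theta A 'X_(lift ord0 i) = \sum_(v : P | v i == z' i) Cvar v.
  move=> zA z'A lt; rewrite thetaX /theta_var liftK; apply: eq_bigl => v.
  by rewrite (upper_thin _ tA zA z'A lt).
rewrite mulrC; case: (ltgtP (val x i) (val y i)) ne => // lt _; last first.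
  by rewrite -(thE _ _ yA xA lt); apply: straight0_mulX.
have tE : theta A 'X_ord0 = \sum_v Cvar v.
  rewrite thetaX /theta_var unlift_none; apply: eq_bigl => v.
  by apply/set0Pn; exists (val x).
have -> : \sum_(v : P | v i == val x i) Cvar v =
   theta A 'X_ord0 - theta A 'X_(lift ord0 i) -
   \sum_(v : P | (v i != val y i) && (v i != val x i)) Cvar v.
  rewrite tE (thE _ _ xA yA lt).
  rewrite [\sum_v Cvar v](bigID (fun v : P => v i == val y i)) /=.
  rewrite [\sum_(v : P | v i != val y i) Cvar v](bigID (fun v : P => v i == val x i)) /=.
  rewrite [X in _ = X - _]addrC addKr addrK; apply: eq_bigl => v.
  by case: (eqVneq (v i) (val x i)) => [->|_]; rewrite ?andbF // andbT lt_eqF.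
rewrite !mulrBl -!scaleN1r; apply: straight0D; first apply: straight0D.
- exact: straight0_mulX.
- by apply: straight0Z; apply: straight0_mulX.
apply: straight0Z; apply: straight0_sr_zero; rewrite mulr_suml.
apply: (big_ind (@sr_zero _ _ _ G)) => [||v /andP[ny nx]].
- exact: sr_zero0.
- exact: sr_zeroD.
rewrite [_ * _](_ : _ = monom G (v :: l')); last by rewrite /monom [RHS]big_cons.
apply: sr_zero_monom; apply/negP=> /simplex_setP[[_ tS] _ _].
have vI z : z \in A -> z \in [set x in v :: l'] by rewrite !inE => ->; rewrite orbT.
have vv : v \in [set z in v :: l'] by rewrite !inE eqxx.
case: (ltgtP (v i) (val x i)) nx => // l1 _.
  exact: (tS _ _ _ vv (vI _ xA) (vI _ yA) i l1 lt).
case: (ltgtP (v i) (val y i)) ny => // l2 _.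
  exact: (tS _ _ _ (vI _ xA) vv (vI _ yA) i l1 l2).
exact: (tS _ _ _ (vI _ xA) (vI _ yA) vv i lt l2).
Qed.

Lemma prodX_monom (l : seq 'I_#|{: vertex G}|) :
  \prod_(k <- l) 'X_k = monom G [seq val (enum_val k) | k <- l].
Proof.
by rewrite /monom big_map; apply: eq_bigr => k _; rewrite Cvar_val /Defs.C enum_valK.
Qed.

(** By linearity the cofactor is a monomial. Then (R1) is absorbed by [sr_zero], (R2) multiplies a
    monomial of nonempty support by its active variable t, and (R3) is [straight0_rat3]. *)
Lemma rat_gen_straight0 a p : rat_gen p -> straight0 (a * p).
Proof.
move=> gp; move: a; apply: mpoly_monom_ind => [a b|c a|l].
- by rewrite mulrDl; apply: straight0D.
- by rewrite -scalerAl; apply: straight0Z.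
rewrite prodX_monom; set l' := map _ _.
case: gp => [s s0 nfs|x|x y i ne].
- apply: straight0_sr_zero; apply: sr_zeroM.
  rewrite (eq_bigr (fun x => Cvar (val x))) => [|x _]; last by rewrite Cvar_val.
  rewrite -(big_map val xpredT Cvar) -/(monom G _); apply: sr_zero_monom.
  by apply: contra nfs => nS; apply: simplex_set_form_simplex.
- rewrite -(Cvar_val x) -(sum_Cvar G xpredT) mulrA [_ * Cvar _]mulrC.
  rewrite [Cvar _ * monom G l'](_ : _ = monom G (val x :: l'));
    last by rewrite /monom big_cons.
  have A0 : [set v in val x :: l'] != set0 by apply/set0Pn; exists (val x); rewrite !inE eqxx.
  rewrite mulrC (_ : \sum_v Cvar v = theta [set v in val x :: l'] 'X_ord0).
    by apply: straight0_mulX (straight_monom _ _); rewrite /active unlift_none.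
  by rewrite thetaX /theta_var unlift_none; apply: eq_bigl => v; rewrite A0.
rewrite -(Cvar_val x) -(Cvar_val y) -(sum_Cvar G (fun v : P => v i == val x i)) mulrA.
rewrite mulrC [monom _ _ * _]mulrC -mulrA.
rewrite [Cvar _ * _](_ : _ = monom G (val x :: val y :: l')); last by rewrite /monom !big_cons.
by rewrite mulrC; apply: straight0_rat3.
Qed.

Lemma Irat_straight0 p : p \in Defs.Irat G -> straight0 p.
Proof.
case/IratP=> s gs ->; rewrite big_seq; apply: (big_ind straight0) => [||x xs].
- exact/straight0_sr_zero/sr_zero0.
- exact: straight0D.
by apply: rat_gen_straight0; apply: gs.
Qed.

(** * The integral basis *)

Definition good_sum (c : {set P} -> int) : Zpoly G := \sum_(s | good_set G s) c s *: sqfree s.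

(** An element of the ideal is also a [comb] without constant terms. The difference of the two
    expressions has the constant terms [c s], which vanish by [sr_zero_comb]. *)
Lemma good_sum_indep c : good_sum c \in Defs.Irat G -> forall s, good_set G s -> c s = 0.
Proof.
case/Irat_straight0=> q [q0 cq] s gs.
have : sr_zero (comb G (fun s => (c s)%:MP - q s)).
  rewrite (_ : comb _ _ = good_sum c - comb G q) //.
  rewrite /comb /good_sum -sumrB; apply: eq_bigr => s' _.
  by rewrite rmorphB mulrBr /= [theta s' _%:MP]mmapC mulrC mul_mpolyC.
move/sr_zero_comb/(_ s gs); rewrite rmorphB /= q0 subr0.
by rewrite /const_term mevalC.
Qed.

(** The converse inclusion of ideals: two points of [s] that differ at [i] make the product a
    multiple of an (R3) generator, and any point of [s] does so for t and (R2). *)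
Lemma sqfree_theta_var s k : good_set G s -> sqfree s * theta_var G s k \in Defs.Irat G.
Proof.
case/andP=> sS _; have [_ vs _] := simplex_setP _ _ sS.
have inG v : v \in s -> {x : vertex G | v = val x}.
  by move=> vI; have vG := introT forallP (vs v vI); exists (Sub v vG).
have [ak|nk] := boolP (active s k); last by rewrite -thetaX theta_inactive // mulr0 rpred0.
move: ak; rewrite /active /theta_var; case: unliftP => [i _|_].
  case/movingP=> u [w [uI wI lt]].
  have [x xE] := inG u uI; have [y yE] := inG w wI.
  have uw : u != w by apply: contraTneq lt => ->; rewrite ltxx.
  have tS : thin s by case: (simplex_setP _ _ sS).
  rewrite (eq_bigl (fun v : P => v i == w i)) => [|v]; last first.
    exact: (upper_thin _ tS uI wI lt).
  rewrite /sqfree (big_setD1 w wI) (big_setD1 u) /=; last by rewrite !inE uw.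
  rewrite (sum_Cvar G (fun v : P => v i == w i)) xE yE !Cvar_val /=.
  set r := \prod_(_ in _) _; rewrite (mulrA (C y)) (mulrAC _ r) (mulrC _ r).
  have yx : val y i != val x i by move: lt; rewrite xE yE; case: ltgtP.
  by apply: idealMr; exact: (rat_gen_Irat (Rat3 yx)).
move=> s0; have /set0Pn[v vI] := s0; have [x xE] := inG v vI.
rewrite (eq_bigl xpredT) => [|v']; last by rewrite s0.
rewrite /sqfree (big_setD1 v vI) /= (sum_Cvar G xpredT) xE Cvar_val.
set r := \prod_(_ in _) _; rewrite (mulrAC _ r) (mulrC _ r).
by apply: idealMr; exact: (rat_gen_Irat (Rat2 x)).
Qed.

Lemma sqfree_theta s q : good_set G s ->
  sqfree s * theta s q - const_term q *: sqfree s \in Defs.Irat G.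
Proof.
move=> gs; move: q; apply: mpoly_monom_ind => [p q pI qI|c p pI|l].
- by rewrite !rmorphD mulrDr scalerDl opprD addrACA rpredD.
- rewrite -mul_mpolyC !rmorphM /= [theta s _%:MP]mmapC /const_term mevalC.
  by rewrite -scalerA mulrCA mul_mpolyC -scalerBr -mul_mpolyC idealMr.
case: l => [|k l].
  by rewrite big_nil !rmorph1 mulr1 scale1r subrr rpred0.
rewrite big_cons !rmorphM /= const_termX mul0r scale0r subr0 mulrA mulrC idealMr //.
by rewrite thetaX sqfree_theta_var.
Qed.

Lemma good_sum_span p : exists c, p - good_sum c \in Defs.Irat G.
Proof.
(* Every set extends [set0], so [set0] is a common reference for all monomials. *)
have [q [_ [qI _]]] : straight set0 p.
  move: p; apply: mpoly_monom_ind => [p q|c p|l]; [exact: straightD|exact: straightZ|].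
  rewrite prodX_monom; apply: straight_extends (straight_monom _ _).
  split=> [|i]; first by rewrite eqxx.
  by case/movingP=> u [w []]; rewrite inE.
exists (fun s => const_term (q s)).
rewrite -(subrK (comb G q) p) -addrA rpredD // /comb /good_sum -sumrB.
by apply: rpred_sum => s gs; apply: sqfree_theta.
Qed.

End Basis.

(** * Restriction and gluing *)

Section ChowBasis.
Variables (disp : Order.disp_t) (d : nat) (V : 'I_d -> finOrderType disp).
Variable G : forall i, graph (V i).
Local Notation P := {dffun forall i, V i}.
Implicit Types (s : {set P}) (c : {set P} -> int).

Lemma chow_class_eq (p q : Zpoly G) :
  chow_class p = chow_class q <-> p - q \in Defs.Irat G.
Proof.
by rewrite Quotient.idealrBE; split=> /eqP.
Qed.

Lemma chow_good_sum (x : Chow G) : exists c, x = chow_class (good_sum G c).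
Proof.
have [p ->] := chow_classP x; have [c pc] := good_sum_span p.
by exists c; apply/chow_class_eq.
Qed.

Lemma good_sumB c c' : good_sum G c - good_sum G c' = good_sum G (fun s => c s - c' s).
Proof. by rewrite /good_sum -sumrB; apply: eq_bigr => s _; rewrite scalerBl. Qed.

Lemma chow_good_sum_inj c c' : chow_class (good_sum G c) = chow_class (good_sum G c') ->
  forall s, good_set G s -> c s = c' s.
Proof.
move=> /chow_class_eq; rewrite good_sumB => /good_sum_indep E s /E /eqP.
by rewrite subr_eq0 => /eqP.
Qed.

Lemma eq_good_sum c c' : (forall s, good_set G s -> c s = c' s) ->
  good_sum G c = good_sum G c'.
Proof. by move=> E; apply: eq_bigr => s /E ->. Qed.

End ChowBasis.

(** * Restriction on the basis *)

Section Restriction.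
Variables (disp : Order.disp_t) (d : nat) (V : 'I_d -> finOrderType disp).
Variables G H : forall i, graph (V i).
Local Notation P := {dffun forall i, V i}.
Implicit Types (s : {set P}) (c : {set P} -> int).
Hypothesis sHG : forall i, subgraph (H i) (G i).

Definition complete (K : forall i, graph (V i)) := forall i x y,
  x \in vset (K i) -> y \in vset (K i) -> x != y -> adj (K i) x y.

Lemma restr_homog n (p : Zpoly G) : p \is n.-homog -> restr_poly H p \is n.-homog.
Proof.
move=> /dhomogP pn; rewrite [p]mpolyE raddf_sum big_seq /=.
apply: rpred_sum => m /pn mn.
rewrite /restr_poly mmapZ mmapX mul_mpolyC; apply: rpredZ.
have <- : (\sum_(k < #|{: vertex G}|) m k)%N = n by rewrite -mn; apply/esym/mdegE.
rewrite /mmap1; elim/big_rec2: _ => [|k q e _ IH]; first exact: dhomog1.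
apply: dhomogM IH.
have /(dhomogMn (m k)) : restr_var H (enum_val k) \is 1.-homog; last by rewrite mul1n.
by case: (restr_varP sHG (enum_val k)) => [w _|_]; rewrite ?rpred0 // dhomogX /= mdeg1.
Qed.

Lemma restr_Cvar v : restr_poly H (Cvar G v) = Cvar H v.
Proof.
have [vG|nv] := boolP [forall i, v i \in vset (G i)]; last first.
  rewrite Cvar_out // rmorph0 Cvar_out //; apply: contra nv => /forallP vH.
  by apply/forallP=> i; case: (sHG i) => /subsetP sub _; apply/sub/vH.
rewrite -[v]/(val (Sub v vG : vertex G)) Cvar_val restr_polyC /restr_var /Cvar.
by [].
Qed.

Lemma restr_sqfree s : restr_poly H (sqfree G s) = sqfree H s.
Proof. by rewrite rmorph_prod; apply: eq_bigr => v _; rewrite /= restr_Cvar. Qed.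

Lemma sqfree_inside s : sqfree H s != 0 -> forall v, v \in s -> forall i, v i \in vset (H i).
Proof.
move=> nz v vs; apply/forallP; apply: contraNT nz => nv.
by rewrite /sqfree (big_setD1 v vs) /= Cvar_out // mul0r.
Qed.

Hypothesis cH : complete H.

Lemma simplex_set_complete s : simplex_set H s =
  simplex_set G s && `[< {in s, forall (v : P) i, v i \in vset (H i)} >].
Proof.
apply/simplex_setP/andP => [[ts vs as_]|[/simplex_setP[ts vs as_] /asboolP vH]].
  split; last exact/asboolP.
  apply/simplex_setP; split=> // [v vI i|u v uI vI i].
    by case: (sHG i) => /subsetP sub _; apply/sub/vs.
  by case: (as_ u v uI vI i) => [|a]; [left|right; case: (sHG i) => _; apply].
split=> // u v uI vI i; have [|ne] := eqVneq (u i) (v i); first by left.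
by right; apply: cH => //; apply: vH.
Qed.

(** Irredundance depends on the points alone and not on the graphs; hence basis monomials restrict
    to basis monomials or to 0. *)
Lemma good_set_complete s : good_set H s =
  good_set G s && `[< {in s, forall (v : P) i, v i \in vset (H i)} >].
Proof. by rewrite /good_set simplex_set_complete andbAC. Qed.

Lemma restr_good_sum c : restr_poly H (good_sum G c) = good_sum H c.
Proof.
rewrite /good_sum raddf_sum /= (bigID (good_set H)) /= [X in _ + X]big1 ?addr0.
  apply: eq_big => [s|s _]; first by rewrite good_set_complete andbA andbb.
  by rewrite -mul_mpolyC rmorphM /= restr_sqfree [restr_poly H _%:MP]mmapC mul_mpolyC.
move=> s /andP[gG gH]; rewrite -mul_mpolyC rmorphM /= restr_sqfree.
have [->|nz] := eqVneq (sqfree H s) 0; first by rewrite mulr0.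
case/negP: gH; rewrite good_set_complete gG; apply/asboolP => v; exact: sqfree_inside.
Qed.

Lemma restr_chow_good_sum c :
  restr sHG (chow_class (good_sum G c)) = chow_class (good_sum H c).
Proof. by rewrite restr_class restr_good_sum. Qed.

End Restriction.

(** * Edges through a vertex and connectedness of the line graph *)

Section Edges.
Variables (T : finType) (G : graph T).
Hypotheses (cG : connected G) (eG : edges G != set0).

Lemma edgeP (e : edge G) : exists x y, adj G x y /\ val e = [set x; y].
Proof. by case/imsetP: (valP e) => -[x y]; rewrite inE => xy E; exists x, y. Qed.

Lemma edge_set x y : adj G x y -> [set x; y] \in edges G.
Proof. by move=> xy; apply/imsetP; exists (x, y); rewrite ?inE. Qed.

Definition edge_of x y (xy : adj G x y) : edge G := Sub [set x; y] (edge_set xy).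

(** On a walk from [x] to an end of some edge, either the walk is trivial and that edge contains
    [x], or its first step is an edge at [x]. *)
Lemma vertex_edge x : x \in vset G -> exists e : edge G, x \in val e.
Proof.
move=> xG; have /set0Pn[e /imsetP[[a b]]] := eG; rewrite inE /= => ab _.
have /connectP[[/= _ ax|y p /andP[xy _] _]] := cG xG (adj_vset ab).
  by exists (edge_of ab); rewrite /= -ax !inE eqxx.
by exists (edge_of xy); rewrite /= !inE eqxx.
Qed.

(** Consecutive edges of a walk share a vertex, and distinct edges with a common vertex are adjacent
    in the line graph. *)
Lemma line_connected (R : Type) (F : edge G -> R) :
  (forall e e', line_adj e e' -> F e = F e') -> forall e e', F e = F e'.
Proof.
move=> FE; have meet x (e e' : edge G) : x \in val e -> x \in val e' -> F e = F e'.
  move=> xe xe'; have [->//|ne] := eqVneq e e'; apply: FE; rewrite /line_adj ne.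
  by apply/set0Pn; exists x; rewrite inE xe.
have walk p x (e e' : edge G) : path (adj G) x p -> x \in val e -> last x p \in val e' ->
    F e = F e'.
  elim: p x e => [|y p IH] x e /=; first by move=> _; apply: meet.
  move=> /andP[xy py] xe le'; rewrite (meet x e (edge_of xy)) //.
    by apply: (IH y) => //; rewrite /= !inE eqxx orbT.
  by rewrite /= !inE eqxx.
move=> e e'; have [x [x' [xx eE]]] := edgeP e; have [y [y' [yy e'E]]] := edgeP e'.
have /connectP[p px yE] := cG (adj_vset xx) (adj_vset yy).
apply: (walk p x) => //; first by rewrite eE !inE eqxx.
by rewrite -yE e'E !inE eqxx.
Qed.

End Edges.

(** * Gluing coefficients over the cubes *)

Section Cubes.
Variables (disp : Order.disp_t) (d : nat) (V : 'I_d -> finOrderType disp).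
Variable G : forall i, graph (V i).
Local Notation P := {dffun forall i, V i}.
Implicit Types (s : {set P}) (c : {set P} -> int) (e : multiedge G).
Hypotheses (cG : forall i, connected (G i)) (eG : forall i, edges (G i) != set0).
Variable lab : labelling G.

Definition inside e s := forall v, v \in s -> forall i, v i \in val (e i).

Lemma cube_complete e : complete (cube e).
Proof. by move=> i x y /= xe ye ne; rewrite /complete_adj xe ye. Qed.

Lemma good_set_cube e s : good_set (cube e) s <-> good_set G s /\ inside e s.
Proof.
rewrite (good_set_complete (cube_sub e)); last exact: cube_complete.
by split=> [/andP[-> /asboolP]|[-> ?]] //; apply/asboolP.
Qed.

Lemma facet_complete i (x : multifacet G i) : complete (facet lab x).
Proof.
rewrite /facet => j; have [ne|/negbNE/eqP->] := boolP (j != i).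
  by rewrite !glue_neq => a b /= ae be ne'; rewrite /complete_adj ae be.
rewrite !glue_eq => a b /=; rewrite !inE => /andP[a1 a2] /andP[b1 b2] ne.
by rewrite /inter_adj /= /complete_adj a1 a2 b1 b2 ne.
Qed.

Lemma facet_vset i (x : multifacet G i) j a :
  a \in val (facet_edge lab x true j) -> a \in val (facet_edge lab x false j) ->
  a \in vset (facet lab x j).
Proof.
rewrite /facet !ffunE; have [ne|/negbNE/eqP ji] := boolP (j != i).
  by rewrite !glue_neq.
by move: a; rewrite ji => a; rewrite !glue_eq /= inE => -> ->.
Qed.

Lemma good_set_facet i (x : multifacet G i) s : good_set G s ->
  inside (facet_edge lab x true) s -> inside (facet_edge lab x false) s ->
  good_set (facet lab x) s.
Proof.
move=> gs it if_.
rewrite (good_set_complete (facet_sub lab x true)); last exact: facet_complete.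
apply/andP; split; first exact/good_set_cube.
apply/asboolP=> v vs j; apply: facet_vset; [exact: it|exact: if_].
Qed.

(** The cube is built coordinatewise: the edge between the two values where [s] moves, and any edge
    through the single value elsewhere. *)
Lemma cube_cover s : simplex_set G s -> exists e, inside e s.
Proof.
move=> sS; suff W i : exists f : edge (G i), forall v, v \in s -> v i \in val f.
  have [f fP] := fin_all_exists W.
  by exists (finfun f) => v vs i; rewrite ffunE; apply: fP.
have [ts vs as_] := simplex_setP _ _ sS.
have [->|s0] := eqVneq s set0.
  by have /set0Pn[f fG] := eG i; exists ((Sub f fG : edge (G i))) => v; rewrite inE.
have [u [w bs]] := boundsP ts s0; have [uI wI _] := bs.
have [mi|ni] := boolP (i \in moving s).
  have uw : adj (G i) (u i) (w i).
    by case: (as_ u w uI wI i) => // E; move: mi; rewrite (moving_neq bs) E eqxx.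
  exists (edge_of uw) => v vI /=; rewrite !inE.
  by case: (bound_val ts bs i vI) => ->; rewrite eqxx ?orbT.
have [f fP] := vertex_edge (@cG i) (eG i) (vs u uI i); exists f => v vI.
have uw : u i = w i by apply/eqP; rewrite -[_ == _]negbK -(moving_neq bs).
by case: (bound_val ts bs i vI) => ->; rewrite -?uw.
Qed.

Section Agree.
Variables (y : {dffun forall e, Chow (cube e)}) (c : multiedge G -> {set P} -> int).
Hypothesis yE : forall e, y e = chow_class (good_sum (cube e) (c e)).
Hypothesis jy : jmap lab y = 0.

(** The monomial of [s] survives in the common facet and is a basis element there, so its two
    coefficients can be compared. *)
Lemma agree_facet i (x : multifacet G i) s : good_set G s ->
  inside (facet_edge lab x true) s -> inside (facet_edge lab x false) s ->
  c (facet_edge lab x true) s = c (facet_edge lab x false) s.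
Proof.
move=> gs it if_; have /ffunP/(_ i)/ffunP/(_ x) := jy.
rewrite /jmap !ffunE => /eqP; rewrite subr_eq0 !yE !restr_chow_good_sum;
  try exact: facet_complete.
by move=> /eqP/chow_good_sum_inj; apply; apply: good_set_facet.
Qed.

Definition upd e i (f : edge (G i)) : multiedge G :=
  finfun (glue (T := fun j => edge (G j)) (fun j => e (val j)) f).

Lemma upd_eq e i f : @upd e i f i = f.
Proof. by rewrite ffunE glue_eq. Qed.

Lemma upd_neq e i f j : j != i -> @upd e i f j = e j.
Proof. by move=> ne; rewrite ffunE glue_neq. Qed.

Lemma agree_line e i (f f' : edge (G i)) s : good_set G s ->
  inside (upd e f) s -> inside (upd e f') s -> line_adj f f' ->
  c (upd e f) s = c (upd e f') s.
Proof.
move=> gs inf inf' ff'.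
pose x : multifacet G i :=
  (finfun (fun j => e (val j)), @edge_of _ (line_graph (G i)) f f' ff').
have facetE b : facet_edge lab x b = upd e (lab i x b).
  apply/ffunP=> j; have [->|ne] := eqVneq j i; first by rewrite upd_eq ffunE glue_eq.
  by rewrite upd_neq // ffunE glue_neq ffunE.
have := agree_facet (x := x) gs; rewrite !facetE.
have := labelsP lab x; rewrite /=.
have nff' : f != f' by case/andP: (ff').
move=> E.
have tE : lab i x true \in [set f; f'] by rewrite E !inE eqxx.
have fE' : lab i x false \in [set f; f'] by rewrite E !inE eqxx orbT.
have f1 : f \in [set lab i x true; lab i x false] by rewrite -E !inE eqxx.
have f2 : f' \in [set lab i x true; lab i x false] by rewrite -E !inE eqxx orbT.
(* The labelling may list [f] and [f'] in either order; equal labels would force [f = f']. *)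
move: tE fE' f1 f2; rewrite !inE => /orP[]/eqP-> /orP[]/eqP->; rewrite ?eqxx ?orbT ?orbF //=.
- by move=> _ /orP[]/eqP E'; rewrite E' eqxx in nff'.
- by move=> _ _; apply.
- by move=> _ _ H; apply/esym/H.
- by move=> /orP[]/eqP E'; rewrite E' eqxx in nff'.
Qed.

(** For nonempty [s] the edges [f] and [f'] both contain the coordinate of a point of [s], so they
    are equal or adjacent. For empty [s] a chain of edges from [f] to [f'] is needed, and every cube
    on the way sees [s]. *)
Lemma agree_upd e i (f f' : edge (G i)) s : good_set G s ->
  inside (upd e f) s -> inside (upd e f') s -> c (upd e f) s = c (upd e f') s.
Proof.
move=> gs inf inf'; have [->//|ne] := eqVneq f f'.
have [s0|/set0Pn[v vs]] := eqVneq s set0.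
  apply: (line_connected (@cG i) (F := fun f => c (upd e f) s)) => f1 f2.
  by apply: agree_line => // v; rewrite s0 inE.
apply: agree_line => //; rewrite /line_adj ne; apply/set0Pn; exists (v i).
by rewrite inE -{1}(upd_eq e f) -{1}(upd_eq e f') inf // inf'.
Qed.

(* The coordinates of e are changed into those of e' one after the other. *)
Lemma agree e e' s : good_set G s -> inside e s -> inside e' s -> c e s = c e' s.
Proof.
move=> gs; have [n] := ubnP #|[set i | e i != e' i]|.
elim: n e => // n IH e; rewrite ltnS => en ine ine'.
have [/eqP|/set0Pn[i]] := boolP ([set i | e i != e' i] == set0).
  move=> /setP E; congr (c _ s); apply/ffunP=> i; apply/eqP.
  by have := E i; rewrite !inE => /negbFE.
rewrite inE => ni.
have eE : e = upd e (e i).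
  by apply/ffunP=> j; have [->|nj] := eqVneq j i; rewrite ?upd_eq ?upd_neq.
have ine2 : inside (upd e (e' i)) s.
  move=> v vs j; have [->|nj] := eqVneq j i; first by rewrite upd_eq ine'.
  by rewrite upd_neq // ine.
transitivity (c (upd e (e' i)) s).
  by rewrite {1}eE; apply: agree_upd => //; rewrite -eE.
apply: IH => //; apply: leq_trans en; apply/proper_card/properP; split.
  apply/subsetP=> j; rewrite !inE; have [->|nj] := eqVneq j i; first by rewrite upd_eq eqxx.
  by rewrite upd_neq.
by exists i; rewrite !inE // upd_eq eqxx.
Qed.

End Agree.
End Cubes.

Theorem theorem1p4 (disp : Order.disp_t) (d : nat)
    (V : 'I_d -> finOrderType disp) (G : forall i, graph (V i))
    (d_gt0 : (0 < d)%N)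
    (G_connected : forall i, connected (G i))
    (G_edge : forall i, edges (G i) != set0)
    (lab : labelling G) :
  [/\ forall (n : nat) (x : Chow G), chow_homog n x ->
        forall e : multiedge G, chow_homog n (restr_cubes x e),
      injective (@restr_cubes disp d V G)
    & forall y : {dffun forall e : multiedge G, Chow (cube e)},
        jmap lab y = 0 <-> exists x : Chow G, restr_cubes x = y].
Proof.
have restrE c e : restr_cubes (chow_class (good_sum G c)) e = chow_class (good_sum (cube e) c).
  by rewrite ffunE restr_chow_good_sum //; apply: cube_complete.
split.
- move=> n x [p pn ->] e; rewrite ffunE restr_class.
  exists (restr_poly (cube e) p) => //; apply: restr_homog pn; exact: cube_sub.
- move=> x x'; have [c ->] := chow_good_sum x; have [c' ->] := chow_good_sum x' => E.
  congr chow_class; apply: eq_good_sum => s gs.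
  (* The coefficient at [s] is read off in a cube that sees [s]. *)
  have [e es] : exists e : multiedge G, inside e s.
    by apply: (cube_cover G_connected G_edge); case/andP: gs.
  have := congr1 (fun z : {dffun forall e, Chow (cube e)} => z e) E.
  by rewrite /= !restrE => /chow_good_sum_inj; apply; apply/good_set_cube.
move=> y; split=> [jy|[x <-]]; last first.
  (* Both restrictions to a facet are the sum with the same coefficients [c], so they cancel. *)
  have [c ->] := chow_good_sum x; apply/ffunP=> i; apply/ffunP=> z.
  by rewrite /jmap !ffunE !restr_chow_good_sum ?subrr //;
    (apply: cube_complete || apply: facet_complete).
have [c yE] := fin_all_exists (fun e => chow_good_sum (y e)).
(* The guard makes the choice total: for sets that are not good any cube serves. *)
have coverP (s : {set {dffun forall i, V i}}) :
    exists e : multiedge G, good_set G s -> inside e s.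
  have [gs|ngs] := boolP (good_set G s).
    have [e es] : exists e : multiedge G, inside e s.
      by apply: (cube_cover G_connected G_edge); case/andP: gs.
    by exists e.
  have [e _] : exists e : multiedge G, inside e set0.
    exact: (cube_cover G_connected G_edge) (simplex_set0 G).
  by exists e.
have [f fE] := fin_all_exists coverP.
(* The coefficient at [s] is taken from the chosen cube [f s]; by [agree] it is the same in every
   cube that sees [s]. *)
exists (chow_class (good_sum G (fun s => c (f s) s))); apply/ffunP=> e.
rewrite restrE yE; congr chow_class; apply: eq_good_sum => s /good_set_cube[gs es].
exact: (agree G_connected yE jy gs (fE s gs) es).
Qed.
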